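(* For every positive integer $t$ there exists $n_0$ such that for all $n\ge n_0$, \[\mathrm{ex}_3(n,\mathrm{Tr}(B_t))=\left\lfloor \frac{(n-1)^2}{4}\right\rfloor,\] and the only $n$-vertex $3$-uniform $\mathrm{Tr}(B_t)$-free hypergraph attaining this value (up to isomorphism) is the one obtained by taking a complete bipartite graph with parts of sizes $\lfloor (n-1)/2\rfloor$ and $\lceil (n-1)/2\rceil$ on $n-1$ vertices, adding one new vertex $z$, and letting the hyperedges be the sets $e\cup\{z\}$ for all edges $e$ of the complete bipartite graph.
   Context: The book graph $B_t$ is the graph consisting of $t$ triangles sharing a common edge, i.e. the complete tripartite graph $K_{1,1,t}$. For a graph $F$ and an integer $r\ge 2$, $\mathrm{Tr}(F)$ denotes the family of $r$-uniform hypergraphs $\mathcal{F}$ for which $V(F)\subseteq V(\mathcal{F})$ and there is a bijection $f$ from the edges of $F$ to the hyperedges of $\mathcal{F}$ with $f(e)\cap V(F)=e$ for every edge $e$ of $F$ (i.e. each edge of $F$ is enlarged to a hyperedge using only vertices outside $V(F)$; equivalently, the trace of $\mathcal{F}$ on $V(F)$ is $F$). An $r$-uniform hypergraph is $\mathrm{Tr}(F)$-free if it contains no subhypergraph isomorphic to a member of $\mathrm{Tr}(F)$. $\mathrm{ex}_r(n,\mathrm{Tr}(F))$ is the maximum number of hyperedges in an $n$-vertex $r$-uniform $\mathrm{Tr}(F)$-free hypergraph. Here $r=3$. *)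

(* Defs.v *)
From mathcomp Require Import all_boot all_order fingroup perm.
Set Implicit Arguments. Unset Strict Implicit. Unset Printing Implicit Defensive.

Definition uniform3 (n : nat) (H : {set {set 'I_n}}) : bool :=
  [forall e in H, #|e| == 3].

(* H contains a member of Tr(B_t): core vertices u, v (spine) and pairwise
   distinct pages w_1..w_t, all distinct; S = V(B_t) = {u,v,w_1,...,w_t};
   for each edge xy of B_t a hyperedge h of H with h ∩ S = {x,y}.
   (Distinct traces force the chosen hyperedges to be distinct, so the map
   edges -> hyperedges is automatically a bijection onto its image.) *)
Definition contains_trB (n t : nat) (H : {set {set 'I_n}}) : bool :=
  [exists u : 'I_n, exists v : 'I_n, exists w : {ffun 'I_t -> 'I_n},
    let S := u |: (v |: [set w i | i : 'I_t]) in
    [&& u != v, injectiveb w, u \notin [set w i | i : 'I_t],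
        v \notin [set w i | i : 'I_t],
        [exists h in H, h :&: S == [set u; v]],
        [forall i : 'I_t, exists h in H, h :&: S == [set u; w i]] &
        [forall i : 'I_t, exists h in H, h :&: S == [set v; w i]]]].

Definition trB_free (n t : nat) (H : {set {set 'I_n}}) : bool :=
  ~~ contains_trB t H.

Definition ex3_trB (n t : nat) : nat :=
  \max_(H : {set {set 'I_n}} | uniform3 H && trB_free t H) #|H|.

Definition partA (n : nat) : {set 'I_n} :=
  [set i : 'I_n | (0 < val i) && (val i <= (n.-1)./2)].
Definition partB (n : nat) : {set 'I_n} :=
  [set i : 'I_n | (n.-1)./2 < val i].
Definition extremal (n : nat) : {set {set 'I_n}} :=
  [set e : {set 'I_n} | [exists z : 'I_n, exists a : 'I_n, exists b : 'I_n,
     [&& val z == 0, a \in partA n, b \in partB n & e == [set z; a; b]]]].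

Definition hiso (n : nat) (H K : {set {set 'I_n}}) : Prop :=
  exists s : {perm 'I_n}, H = [set (s @: e) | e : {set 'I_n} in K].

(* Main.v *)
Require Import Defs.
From mathcomp Require Import all_boot all_order fingroup perm all_algebra.
From mathcomp Require Import zify ring lra.
Set Implicit Arguments. Unset Strict Implicit. Unset Printing Implicit Defensive.
Import Order.TTheory GRing.Theory Num.Theory.

(** Call a pair of vertices thick if it lies in at least two hyperedges, and a
    hyperedge full if all its pairs are thick. A large set of pages [w] for a
    shadow pair [uv], in which every [uw] lies in a hyperedge avoiding [v] and
    every [vw] in one avoiding [u], already yields a member of Tr(B_t): each
    page conflicts with at most two others, so many pages are conflict-free.
    Hence a shadow pair lies in boundedly many triangles of thick pairs, and by
    the triangle removal (Ruzsa-Szemeredi) argument only o(n^2) hyperedges are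
    full. Every other hyperedge owns a pair that lies in no other hyperedge;
    choosing one own pair for each of them gives a graph in which every edge
    lies in boundedly many triangles. It has about n^2/4 edges, so it is nearly
    complete bipartite, with classes enlarged to [A] and [B] by all vertices
    that miss few neighbours.

    The pages argument shows that no shadow pair lies inside [A] or inside [B],
    so every hyperedge meets the remainder [Z]. If [Z] is a single vertex, then
    |H| <= |A||B| and equality forces the extremal configuration. If |Z| >= 2,
    then compared with floor((n-1)^2/4) one loses of order n own pairs for each
    vertex of [Z] except one, whereas full hyperedges bring almost nothing: a
    full hyperedge through a centre (a vertex of [Z] joined to many vertices in
    both classes) uses up a thick pair between [A] and [B], and each remaining
    full hyperedge contains one of few pairs. *)

(** * Triangles in graphs with few triangles on each edge *)

Local Open Scope ring_scope.

Lemma sum_const_set (P : finType) (Q : pred P) (c : rat) :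
  \sum_(q | Q q) c = #|[set q | Q q]|%:R * c.
Proof. by rewrite sumr_const mulr_natl cardsE. Qed.

Lemma sum_indicator (P : finType) (Q : pred P) :
  \sum_p (Q p)%:R = #|[set p | Q p]|%:R :> rat.
Proof.
rewrite -[RHS]mulr1 -sum_const_set [RHS]big_mkcond /=.
by apply: eq_bigr => p _; case: (Q p).
Qed.

(** * Conditional expectations on the blocks of a colouring, and their energy *)

Section ConditionalExpectation.
Variables (P : finType) (f : P -> rat).

(** Conditional expectation of [f] on the blocks of [k]; the convention for division by zero makes
    it 0 on an empty block. *)
Definition block_mean (D : finType) (k : P -> D) (d : D) : rat :=
  (\sum_(q | k q == d) f q) / #|[set q | k q == d]|%:R.

(** Characteristic property of the conditional expectation: weights that are constant on blocks do
    not distinguish [f] from its block means. *)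
Lemma sum_block_mean (D : finType) (k : P -> D) (phi : D -> rat) :
  \sum_p f p * phi (k p) = \sum_p block_mean k (k p) * phi (k p).
Proof.
rewrite (partition_big k xpredT) //= [RHS](partition_big k xpredT) //=.
apply: eq_bigr => d _.
rewrite (eq_bigr (fun q => f q * phi d)); last by move=> q /eqP ->.
rewrite [RHS](eq_bigr (fun q => block_mean k d * phi d)); last by move=> q /eqP ->.
rewrite -mulr_suml sum_const_set mulrA; congr (_ * _).
rewrite /block_mean; have [/eqP|nz] := eqVneq #|[set q | k q == d]| 0%N.
  rewrite cards_eq0 => /eqP e0; rewrite e0 cards0 mul0r big1 // => q kq.
  by move/setP/(_ q): e0; rewrite !inE kq.
by rewrite mulrC divfK // pnatr_eq0.
Qed.

Definition energy (D : finType) (k : P -> D) : rat :=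
  \sum_p block_mean k (k p) ^+ 2.

(** Pythagoras: the coarse mean is constant on the fine blocks, so it is orthogonal to the
    difference of the two means. *)
Lemma energy_refine (D D' : finType) (k : P -> D) (k' : P -> D') (pi : D' -> D) :
  (forall p, pi (k' p) = k p) ->
  energy k' = energy k +
    \sum_p (block_mean k' (k' p) - block_mean k (k p)) ^+ 2.
Proof.
move=> kE.
have cross : \sum_p block_mean k' (k' p) * block_mean k (k p) = energy k.
  rewrite /energy -(eq_bigr _ (fun p _ => congr1 (fun d => _ * block_mean k d) (kE p))).
  rewrite -(sum_block_mean k' (fun d => block_mean k (pi d))).
  rewrite (eq_bigr _ (fun p _ => congr1 (fun d => f p * block_mean k d) (kE p))).
  by rewrite sum_block_mean; apply: eq_bigr => p _; rewrite expr2.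
rewrite (eq_bigr (fun p => block_mean k' (k' p) ^+ 2 + block_mean k (k p) ^+ 2
    - 2 * (block_mean k' (k' p) * block_mean k (k p)))); last first.
  by move=> p _; ring.
rewrite sumrB big_split /= -mulr_sumr cross -!/(energy _).
ring.
Qed.

(** [J] selects a union of blocks of [k'], on which [f] and its fine means have the same sum. The
    gain can therefore be expressed by [f] itself, with [lam] left free for later tuning. *)
Lemma energy_gain (D D' : finType) (k : P -> D) (k' : P -> D') (pi : D' -> D)
    (J : D' -> bool) (lam : rat) :
  (forall p, pi (k' p) = k p) ->
  energy k + \sum_(p | J (k' p)) (2 * lam * (block_mean k (k p) - f p) - lam ^+ 2)
    <= energy k'.
Proof.
move=> kE; rewrite (energy_refine kE) lerD2l.
have -> : \sum_(p | J (k' p)) (2 * lam * (block_mean k (k p) - f p) - lam ^+ 2)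
   = \sum_(p | J (k' p))
      (2 * lam * (block_mean k (k p) - block_mean k' (k' p)) - lam ^+ 2).
  have E := sum_block_mean k' (fun d => (J d)%:R).
  have {}E : \sum_(p | J (k' p)) f p = \sum_(p | J (k' p)) block_mean k' (k' p).
    rewrite big_mkcond [RHS]big_mkcond /=.
    have <- : \sum_p f p * (J (k' p))%:R = \sum_p (if J (k' p) then f p else 0).
      by apply: eq_bigr => p _; case: (J _); rewrite ?mulr1 ?mulr0.
    rewrite E; apply: eq_bigr => p _; case: (J _); by rewrite ?mulr1 ?mulr0.
  by rewrite !sumrB -!mulr_sumr !sumrB E.
rewrite big_mkcond /=; apply: ler_sum => p _; case: (J _); last exact: sqr_ge0.
(* The square is bounded below by its tangent, so no Cauchy-Schwarz is needed. *)
rewrite -subr_ge0.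
have -> : forall a b : rat, (a - b) ^+ 2 - (2 * lam * (b - a) - lam ^+ 2) = (a - b + lam) ^+ 2.
  by move=> a b; ring.
exact: sqr_ge0.
Qed.

Lemma energy_ge0 (D : finType) (k : P -> D) : 0 <= energy k.
Proof. by apply: sumr_ge0 => p _; apply: sqr_ge0. Qed.

Lemma energy_le_card (D : finType) (k : P -> D) :
  (forall p, 0 <= f p <= 1) -> energy k <= #|P|%:R.
Proof.
move=> f01; rewrite -sum1_card natr_sum; apply: ler_sum => p _.
rewrite expr_le1 //.
  rewrite /block_mean; have [->|nz] := eqVneq #|[set q | k q == k p]| 0%N.
    by rewrite invr0 mulr0.
  rewrite ler_pdivrMr ?ltr0n ?lt0n // mul1r -[leRHS]mulr1 -sum_const_set.
  by apply: ler_sum => q _; case/andP: (f01 q).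
rewrite /block_mean divr_ge0 //; apply: sumr_ge0 => q _.
by case/andP: (f01 q).
Qed.

End ConditionalExpectation.

(** * Triangle removal by energy increment *)

Section RemovalLemma.
Variables (V : finType) (g : rel V).

Definition edge_ind (p : V * V) : rat := (g p.1 p.2)%:R.
Definition pair_col (C : finType) (col : V -> C) (p : V * V) : C * C :=
  (col p.1, col p.2).
Definition in_nbhd (z : V) (p : V * V) := g z p.1 && g z p.2.

(* The neighbourhood of [z] cuts out of the cell [d] a positive proportion that
   carries far fewer edges than the density of [d] predicts. *)
Definition sparse_witness (C : finType) (col : V -> C) (th : rat) (d : C * C) (z : V) :=
  let M : rat := #|[set p | (pair_col col p == d) && in_nbhd z p]|%:R in
  [&& th <= block_mean edge_ind (pair_col col) d,
      \sum_(p | (pair_col col p == d) && in_nbhd z p) edge_ind p <= th / 4 * M &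
      th ^+ 2 * #|[set p | pair_col col p == d]|%:R <= M].

(* Every class is cut by the neighbourhoods of the chosen witnesses of all cells
   in its row and in its column, whence the factor [4 ^ #|C|]. *)
Lemma energy_step (C : finType) (col : V -> C) (th : rat) :
  0 < th ->
  th * #|V|%:R ^+ 2 <= #|[set p | [exists z, sparse_witness col th (pair_col col p) z]]|%:R ->
  exists (C' : finType) (col' : V -> C'),
    #|C'| = (#|C| * 4 ^ #|C|)%N /\
    energy edge_ind (pair_col col) + th ^+ 5 / 2 * #|V|%:R ^+ 2
      <= energy edge_ind (pair_col col').
Proof.
move=> th_gt0 many.
pose wit d := [pick z | sparse_witness col th d z].
pose nbr d v := if wit d is Some z then g z v else false.
pose C' : finType := (C * {ffun C -> bool} * {ffun C -> bool})%type.
pose col' v : C' := (col v, [ffun j => nbr (col v, j) v], [ffun i => nbr (i, col v) v]).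
exists C', col'; split.
  by rewrite !card_prod !card_ffun card_bool -mulnA -expnMn.
pose pi (d : C' * C') : C * C := (d.1.1.1, d.2.1.1).
(* [J] holds of the pairs inside the neighbourhood of the witness of their own cell: one bit is read
   from the row of the first vertex, the other from the column of the second. *)
pose J (d : C' * C') := d.1.1.2 d.2.1.1 && d.2.2 d.1.1.1.
have kE p : pi (pair_col col' p) = pair_col col p by [].
have JE p : J (pair_col col' p) =
    if wit (pair_col col p) is Some z then in_nbhd z p else false.
  by rewrite /J /= !ffunE /nbr /in_nbhd /pair_col; case: (wit _).
(* With [lam = th / 2], a drop of the density from at least [th] to at most [th / 4] on the selected
   part of a cell gains at least [th ^+ 2 / 2] per selected pair on average; the selected part is at
   least a proportion [th ^+ 2] of the cell. *)
apply: le_trans (energy_gain edge_ind J (th / 2) kE); rewrite lerD2l.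
set F := (X in \sum_(p | _) X p).
rewrite (partition_big (pair_col col) xpredT) //=.
have step d : th ^+ 4 / 2 * \sum_(p | pair_col col p == d)
      ([exists z, sparse_witness col th (pair_col col p) z])%:R
    <= \sum_(p | J (pair_col col' p) && (pair_col col p == d)) F p.
  rewrite (eq_bigr (fun=> [exists z, sparse_witness col th d z]%:R)); last first.
    by move=> p /eqP ->.
  rewrite sum_const_set.
  have -> : \sum_(p | J (pair_col col' p) && (pair_col col p == d)) F p =
      \sum_(p | (pair_col col p == d) && (if wit d is Some z then in_nbhd z p else false))
        (th * (block_mean edge_ind (pair_col col) d - edge_ind p) - (th / 2) ^+ 2).
    apply: eq_big => [p|p]; first by rewrite JE andbC; case: eqP => //= ->.
    by case/andP=> _ /eqP <-; rewrite /F; congr (_ * _ - _); field.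
  rewrite /wit; case: pickP => [z|no]; last first.
    rewrite big_pred0; last by move=> p; rewrite andbF.
    by case: existsP => [[z]|_]; rewrite ?no // mulr0 mulr0.
  move=> Wz; have -> : [exists z, sparse_witness col th d z].
    by apply/existsP; exists z.
  rewrite mulr1; case/and3P: Wz; set M : rat := #|_|%:R => den spa big.
  rewrite sumrB -mulr_sumr sumrB !sum_const_set -/M.
  set E := \sum_(p | _) _ in spa *; set b := block_mean _ _ _ in den *.
  set n := (#|_|%:R : rat) in big *.
  have M0 : 0 <= M by [].
  have h1 : th ^+ 2 * M <= th * b * M by rewrite expr2 ler_wpM2r // ler_pM2l.
  have h2 : th * E <= th * (th / 4 * M) by rewrite ler_pM2l.
  have h3 : th ^+ 2 * (th ^+ 2 * n) <= th ^+ 2 * M by rewrite ler_pM2l // exprn_gt0.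
  have arith (t m c e k : rat) : t ^+ 2 * m <= t * c * m -> t * e <= t * (t / 4 * m) ->
      t ^+ 2 * (t ^+ 2 * k) <= t ^+ 2 * m ->
      t ^+ 4 / 2 * k <= t * (m * c - e) - m * (t / 2) ^+ 2 by nra.
  exact: arith.
apply: le_trans (ler_sum _ (fun d _ => step d)).
rewrite -mulr_sumr.
set X := (X in \sum_i \sum_(p | _) X p).
have -> : \sum_i \sum_(p | pair_col col p == i) X p = \sum_p X p.
  by rewrite [RHS](partition_big (pair_col col) xpredT).
rewrite /X sum_indicator.
apply: (@le_trans _ _ (th ^+ 4 / 2 * (th * #|V|%:R ^+ 2))).
  by rewrite le_eqVlt; apply/orP; left; apply/eqP; field.
by rewrite ler_pM2l // divr_gt0 ?exprn_gt0.
Qed.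

Definition triangles : {set V * V * V} :=
  [set p | [&& g p.1.1 p.1.2, g p.1.1 p.2 & g p.1.2 p.2]].

Hypothesis g_sym : symmetric g.
Variable T : nat.
Hypothesis few_common : forall x y, g x y -> (#|[set z | g x z && g y z]| <= T)%N.

Lemma card_fibers (P D : finType) (A : {set P}) (S : {set D}) (h : P -> D) :
  (forall p, p \in A -> h p \in S) ->
  (forall d, d \in S -> (#|[set p in A | h p == d]| <= T)%N) ->
  (#|A| <= T * #|S|)%N.
Proof.
move=> AS fib; rewrite -sum1_card (partition_big h (mem S)) //= mulnC.
rewrite -sum_nat_const; apply: leq_sum => d dS.
by rewrite sum1dep_card -[X in (X <= _)%N]cardsE; apply: leq_trans (fib d dS); rewrite cardsE.
Qed.

(** An edge extends to at most [T] triangles and a non-edge to none, so removing the pairs of [S]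
    destroys few triangles. *)
Lemma triangles_fst (S : {set V * V}) :
  (#|[set p in triangles | p.1 \in S]| <= T * #|S|)%N.
Proof.
apply: (@card_fibers _ _ _ _ fst) => [p|[x y] _]; first by rewrite inE => /andP[].
case gxy: (g x y); last first.
  rewrite (_ : [set _ in _ | _] = set0) ?cards0 //; apply/setP=> -[[x' y'] z].
  by rewrite !inE /= xpair_eqE; apply/negP => /andP[/andP[/and3P[h _ _] _] /andP[/eqP e1 /eqP e2]]; rewrite e1 e2 gxy in h.
apply: leq_trans (few_common gxy).
rewrite -(card_imset [set z | g x z && g y z] (_ : injective (fun z => (x, y, z)))); last by move=> ? ? [].
apply/subset_leq_card/subsetP => -[[x' y'] z]; rewrite !inE /= xpair_eqE.
case/andP=> /andP[/and3P[_ h1 h2] _] /andP[/eqP e1 /eqP e2]; subst.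
by apply/imsetP; exists z; rewrite // inE h1.
Qed.

Lemma triangles_left (S : {set V * V}) :
  (#|[set p in triangles | (p.1.1, p.2) \in S]| <= T * #|S|)%N.
Proof.
apply: leq_trans (triangles_fst S).
rewrite -(card_imset _ (_ : injective (fun p : V * V * V => (p.1.1, p.2, p.1.2)))).
  apply/subset_leq_card/subsetP => _ /imsetP[[[x y] z] + ->]; rewrite !inE /=.
  by case/andP=> /and3P[-> -> h] ->; rewrite g_sym h.
by move=> [[? ?] ?] [[? ?] ?] [-> -> ->].
Qed.

Lemma triangles_right (S : {set V * V}) :
  (#|[set p in triangles | (p.1.2, p.2) \in S]| <= T * #|S|)%N.
Proof.
apply: leq_trans (triangles_left S).
rewrite -(card_imset _ (_ : injective (fun p : V * V * V => (p.1.2, p.1.1, p.2)))).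
  apply/subset_leq_card/subsetP => _ /imsetP[[[x y] z] + ->]; rewrite !inE /=.
  by case/andP=> /and3P[h -> ->] ->; rewrite g_sym h.
by move=> [[? ?] ?] [[? ?] ?] [-> -> ->].
Qed.

(** * Cleaning a colouring: sparse cells, low degrees and tiny classes *)

Section Cleaning.
Variables (C : finType) (col : V -> C) (th : rat).
Hypothesis th_gt0 : 0 < th.

Let class x := [set v | col v == col x].
Let nclass x z := [set v in class x | g v z].

(** The edges in sparse cells are counted by summing the block means over these cells, and each such
    mean is below [th]. *)
Lemma low_density_pairs :
  #|[set p | g p.1 p.2 && (block_mean edge_ind (pair_col col) (pair_col col p) < th)]|%:R
    <= th * #|V|%:R ^+ 2.
Proof.
rewrite -sum_indicator.
rewrite (eq_bigr (fun p => edge_ind p *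
    (block_mean edge_ind (pair_col col) (pair_col col p) < th)%R%:R)); last first.
  by move=> p _; rewrite /edge_ind -natrM mulnb.
rewrite (sum_block_mean _ _ (fun d => (block_mean edge_ind (pair_col col) d < th)%R%:R)).
have -> : #|V|%:R ^+ 2 = \sum_(p : V * V) 1 :> rat.
  by rewrite sum_const_set cardsT card_prod natrM mulr1 expr2.
rewrite mulr_sumr; apply: ler_sum => p _.
by case: ltP => h; rewrite ?mulr1 ?mulr0 ltW.
Qed.

(** For a fixed second vertex [z] and a fixed class, the counted vertices are all neighbours of [z]
    in the class if these form less than a proportion [th] of it, and none otherwise. *)
Lemma low_degree_pairs :
  #|[set p | g p.1 p.2 && (#|nclass p.1 p.2|%:R < th * #|class p.1|%:R)]|%:R
    <= th * #|V|%:R ^+ 2.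
Proof.
rewrite -sum_indicator.
have row z : #|[set x | g x z && (#|nclass x z|%:R < th * #|class x|%:R)]|%:R <= th * #|V|%:R.
  rewrite -sum_indicator (partition_big col xpredT) //=.
  have -> : #|V|%:R = \sum_(x : V) 1 :> rat by rewrite sum_const_set cardsT mulr1.
  rewrite (partition_big col xpredT) //= mulr_sumr; apply: ler_sum => i _.
  have cE x : col x == i -> #|class x| = #|[set v | col v == i]|.
    by move=> /eqP xi; rewrite /class xi.
  have nE x : col x == i -> #|nclass x z| = #|[set v | (col v == i) && g v z]|.
    by move=> /eqP xi; apply: eq_card => v; rewrite !inE xi.
  set a : rat := #|[set v | (col v == i) && g v z]|%:R.
  set b : rat := #|[set v | col v == i]|%:R.
  rewrite (eq_bigr (fun x => (a < th * b)%R%:R * (g x z)%:R)); last first.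
    by move=> x xi; rewrite cE // nE // -/a -/b -natrM mulnb andbC.
  rewrite -mulr_sumr [X in _ <= th * X]sum_const_set mulr1 -/b.
  have -> : \sum_(x | col x == i) (g x z)%:R = a.
    rewrite /a -sum_indicator [LHS]big_mkcond; apply: eq_bigr => x _.
    by case: (col x == i).
  by case: ltP => h; rewrite ?mul1r ?mul0r ?mulr_ge0 // ltW.
rewrite (eq_bigr (fun p => (fun x z => (g x z && (#|nclass x z|%:R < th * #|class x|%:R)%R)%:R)
   p.1 p.2)) // -(pair_bigA _ (fun x z => (g x z && (#|nclass x z|%:R < th * #|class x|%:R)%R)%:R)).
rewrite /= exchange_big /=.
apply: (@le_trans _ _ (\sum_(z : V) th * #|V|%:R)).
  by apply: ler_sum => z _; rewrite sum_indicator.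
by rewrite sum_const_set cardsT mulrCA expr2.
Qed.

Lemma tiny_pairs (tau : rat) : 0 <= tau ->
  #|[set p : V * V | #|class p.2|%:R < tau]|%:R <= #|C|%:R * tau * #|V|%:R.
Proof.
move=> tau0.
have -> : [set p : V * V | #|class p.2|%:R < tau] = setX setT [set y | #|class y|%:R < tau].
  by apply/setP => -[x y]; rewrite !inE.
rewrite cardsX cardsT natrM mulrC ler_wpM2r //.
rewrite -sum_indicator (partition_big col xpredT) //= -[#|C|%:R * _]mul1r mulrCA mul1r.
rewrite -cardsT -sum_const_set; apply: ler_sum => i _.
rewrite (eq_bigr (fun=> (#|[set v | col v == i]|%:R < tau)%R%:R)); last first.
  by move=> x /eqP xi; rewrite /class xi.
rewrite sum_const_set.
by case: ltP => h; rewrite ?mulr1 ?mulr0 // ltW.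
Qed.

(** By the degree bounds, the neighbourhood of [z] cuts a proportion [th ^+ 2] out of the cell. Each
    of its vertices [u] is adjacent to [z], so the edge [uz] leaves [u] at most [T] neighbours
    there; since the class of [y] is not tiny, this is far below the density [th]. *)
Lemma triangle_witness x y z :
  g x y -> g x z -> g y z ->
  th <= block_mean edge_ind (pair_col col) (col x, col y) ->
  th * #|class x|%:R <= #|nclass x z|%:R ->
  th * #|class y|%:R <= #|nclass y z|%:R ->
  T%:R * 4 / th ^+ 2 <= #|class y|%:R ->
  sparse_witness col th (col x, col y) z.
Proof.
move=> gxy gxz gyz den cx cy tiny.
have MX : [set p | (pair_col col p == (col x, col y)) && in_nbhd z p]
    = setX (nclass x z) (nclass y z).
  apply/setP => -[u v]; rewrite !inE /= /in_nbhd xpair_eqE /= !(g_sym z).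
  by rewrite andbACA.
have NX : [set p | pair_col col p == (col x, col y)] = setX (class x) (class y).
  by apply/setP => -[u v]; rewrite !inE /= xpair_eqE.
apply/and3P; split=> //; rewrite !MX !cardsX !natrM.
  have le1 : \sum_(p | (pair_col col p == (col x, col y)) && in_nbhd z p) edge_ind p
      <= #|nclass x z|%:R * T%:R.
    rewrite -sum_const_set.
    rewrite (eq_bigl (fun p => (p.1 \in nclass x z) && (p.2 \in nclass y z))); last first.
      by case=> u v; move/setP/(_ (u, v)): MX; rewrite in_set in_setX.
    rewrite -(pair_big_dep (fun u => u \in nclass x z) (fun u v => v \in nclass y z)
        (fun u v => edge_ind (u, v))) /=.
    rewrite [leRHS](eq_bigl (fun u => u \in nclass x z)); last by move=> u; rewrite [RHS]inE.
    apply: ler_sum => u; rewrite inE => /andP[_ guz].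
    apply: (@le_trans _ _ (\sum_v (g u v && g z v)%:R)).
      rewrite big_mkcond; apply: ler_sum => v _; rewrite inE /edge_ind /=.
      by rewrite (g_sym z); case: (v \in class y); case: (g u v); case: (g v z); rewrite /= ?lexx ?ler0n.
    by rewrite sum_indicator ler_nat few_common.
  apply: le_trans le1 _; rewrite mulrCA ler_wpM2l //.
  move: tiny cy; set a : rat := #|class y|%:R; set b : rat := #|nclass y z|%:R => tiny cy.
  have : th / 4 * (th * a) <= th / 4 * b by rewrite ler_pM2l // divr_gt0.
  apply: le_trans; move: tiny; rewrite ler_pdivrMr ?exprn_gt0 // expr2; lra.
by rewrite NX cardsX natrM expr2 mulrACA ler_pM // mulr_ge0 // ltW.
Qed.

(** A triangle that survives the cleaning has a witness, so its first pair is irregular. Every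
    triangle thus uses a pair from one of five sets; low degree is needed for both pairs ending in
    the third vertex, which gives [4 * th] as one share for density, two for degree and one for
    irregularity. *)
Lemma triangles_or_irregular :
  th * #|V|%:R ^+ 2 <= #|[set p | [exists z, sparse_witness col th (pair_col col p) z]]|%:R
  \/ #|triangles|%:R <= T%:R * (4 * th * #|V|%:R ^+ 2
        + #|C|%:R * (T%:R * 4 / th ^+ 2) * #|V|%:R).
Proof.
set I := [set p | _]; have [/ltW le|] := ltrP (th * #|V|%:R ^+ 2) #|I|%:R; first by left.
move=> Ile; right.
set tau := T%:R * 4 / th ^+ 2.
have tau0 : 0 <= tau by rewrite divr_ge0 ?sqr_ge0 ?mulr_ge0.
have b1 := low_density_pairs; have b2 := low_degree_pairs; have b3 := tiny_pairs tau0.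
set S1 := [set p | _] in b1; set S2 := [set p | _] in b2; set S3 := [set p | _] in b3.
have c1 := triangles_fst S1; have c2 := triangles_left S2; have c3 := triangles_right S2.
have c4 := triangles_fst S3; have c5 := triangles_fst I.
set A1 := [set p in _ | _] in c1; set A2 := [set p in _ | _] in c2.
set A3 := [set p in _ | _] in c3; set A4 := [set p in _ | _] in c4.
set A5 := [set p in _ | _] in c5.
have sub : triangles \subset A1 :|: A2 :|: A3 :|: A4 :|: A5.
  apply/subsetP => -[[x y] z]; rewrite !inE /= => /and3P[gxy gxz gyz].
  rewrite gxy gxz gyz /=.
  case: ltP => //= h1; case: ltP => //= h2; case: ltP => //= h3; case: ltP => //= h4.
  by apply/existsP; exists z; apply: triangle_witness.
have le5 : (#|triangles| <= #|A1| + #|A2| + #|A3| + #|A4| + #|A5|)%N.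
  have U (X Y : {set V * V * V}) := leq_of_leqif (leq_card_setU X Y).
  apply: leq_trans (subset_leq_card sub) _; apply: leq_trans (U _ _) _; rewrite leq_add2r.
  apply: leq_trans (U _ _) _; rewrite leq_add2r.
  by apply: leq_trans (U _ _) _; rewrite leq_add2r; apply: U.
have {le5} le5 : (#|triangles| <= T * (#|S1| + #|S2| + #|S2| + #|S3| + #|I|))%N.
  by rewrite !mulnDr (leq_trans le5) // !leq_add.
have : (#|triangles|%:R : rat) <= (T * (#|S1| + #|S2| + #|S2| + #|S3| + #|I|))%:R by rewrite ler_nat.
move/le_trans; apply; rewrite natrM ler_wpM2l // !natrD.
move: b1 b2 b3 Ile; lra.
Qed.
End Cleaning.
End RemovalLemma.

(** As long as many pairs are irregular, the colouring can be refined with an energy gain of order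
    [#|V| ^ 2]. The energy never exceeds [#|V| ^ 2], so within a bounded number of rounds the other
    alternative of [triangles_or_irregular] occurs. *)
Theorem few_triangles (T : nat) (e : rat) : 0 < e -> exists n0 : nat,
  forall (V : finType) (g : rel V), symmetric g ->
    (forall x y, g x y -> (#|[set z | g x z && g y z]| <= T)%N) ->
    (n0 <= #|V|)%N -> #|triangles g|%:R <= e * #|V|%:R ^+ 2.
Proof.
move=> e0.
have T0 : 0 < (T%:R + 1 : rat) by rewrite ltr_wpDl.
(* This makes [4 * th * T] at most [e / 2]; the other half of [e] is kept for the term linear in
   [#|V|]. *)
pose th := e / (8 * (T%:R + 1)).
have th0 : 0 < th by rewrite divr_gt0 // mulr_gt0.
have eE : e = 8 * (T%:R + 1) * th.
  by rewrite /th mulrC divfK // lt0r_neq0 // mulr_gt0.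
clearbody th; pose c := th ^+ 5 / 2.
have c0 : 0 < c by rewrite divr_gt0 // exprn_gt0.
pose J := Num.bound c^-1.
have Jc : 1 < J%:R * c.
  have /archi_boundP : 0 <= c^-1 by rewrite invr_ge0 ltW.
  by rewrite -/J -[c^-1]mul1r ltr_pdivrMr.
(* [K j] bounds the number of colours after [j] rounds, following the growth in [energy_step]. *)
pose K j := iter j (fun k => k * 4 ^ k)%N 1%N.
have Kmon i j : (i <= j)%N -> (K i <= K j)%N.
  move=> /subnK <-; elim: (j - i)%N => // d IH; apply: leq_trans IH _.
  by rewrite addSn /= leq_pmulr // expn_gt0.
pose b := T%:R * (K J)%:R * (T%:R * 4 / th ^+ 2) / (e / 2).
have b0 : 0 <= b by rewrite !(divr_ge0, mulr_ge0, sqr_ge0) // ltW.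
exists (Num.bound b).+1 => V g gs gT nV.
set n : rat := #|V|%:R.
have n0 : 0 < n by rewrite ltr0n (leq_ltn_trans _ nV).
have bn : T%:R * (K J)%:R * (T%:R * 4 / th ^+ 2) <= e / 2 * n.
  have : b <= n.
    apply/ltW/(lt_le_trans (archi_boundP b0)).
    by rewrite ler_nat ltnW.
  by rewrite /b ler_pdivrMr ?divr_gt0 // [n * _]mulrC.
rewrite leNgt; apply/negP => many.
have iter j : (j <= J)%N -> exists (C : finType) (col : V -> C), (#|C| <= K j)%N /\
    j%:R * c * n ^+ 2 <= energy (edge_ind g) (pair_col col).
  elim: j => [_|j IH jJ].
    exists (unit : finType), (fun=> tt); rewrite card_unit; split=> //.
    by rewrite !mul0r energy_ge0.
  have [C [col [Cj en]]] := IH (ltnW jJ).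
  have [irr|] := @triangles_or_irregular _ _ gs _ gT _ col _ th0; last first.
    move/(lt_le_trans many); suff /le_lt_trans h : T%:R * (4 * th * n ^+ 2 +
        #|C|%:R * (T%:R * 4 / th ^+ 2) * n) <= e * n ^+ 2 by move/h; rewrite ltxx.
    have h1 : T%:R * (4 * th * n ^+ 2) <= e / 2 * n ^+ 2.
      have : 0 <= th * n ^+ 2 by rewrite mulr_ge0 ?sqr_ge0 // ltW.
      by rewrite eE; lra.
    have h2 : T%:R * (#|C|%:R * (T%:R * 4 / th ^+ 2) * n) <= e / 2 * n ^+ 2.
      apply: (@le_trans _ _ (T%:R * (K J)%:R * (T%:R * 4 / th ^+ 2) * n)).
        rewrite !mulrA !ler_wpM2r ?invr_ge0 ?sqr_ge0 ?(ltW n0) // ler_wpM2l // ler_nat.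
        exact: leq_trans Cj (Kmon _ _ (ltnW jJ)).
      by rewrite [n ^+ 2]expr2 [e / 2 * _]mulrA ler_wpM2r // ltW.
    by rewrite mulrDr (le_trans (lerD h1 h2)) //; lra.
  have [C' [col' [C'E en']]] := energy_step th0 irr.
  exists C', col'; split.
    by rewrite C'E /= leq_mul // leq_pexp2l.
  by apply: le_trans en'; rewrite -natr1 !mulrDl mul1r lerD.
have [C [col [_ en]]] := iter J (leqnn J).
have /(le_trans en) : energy (edge_ind g) (pair_col col) <= #|{: V * V}|%:R.
  by apply: energy_le_card => p; rewrite /edge_ind; case: (g _ _); rewrite /= ?lexx ?ler01.
rewrite card_prod natrM -expr2 -[leRHS]mul1r ler_pM2r ?exprn_gt0 // leNgt.
by rewrite Jc.
Qed.

Local Close Scope ring_scope.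

(** * Pages of a book in the trace *)

Definition shadow (V : finType) (H : {set {set V}}) : rel V :=
  fun x y => (x != y) && [exists h in H, (x \in h) && (y \in h)].

Definition pair_avoiding (V : finType) (H : {set {set V}}) (x y z : V) :=
  [exists h in H, [&& x \in h, y \in h & z \notin h]].

(** Greedy choice: with out-degrees at most 2, some vertex of [W] has in-degree at most 2 within
    [W]. Choosing it costs at most five vertices: itself, two out-neighbours and two
    in-neighbours. *)
Lemma sparse_digraph_independent (V : finType) (f : V -> {set V}) (t : nat) (W : {set V}) :
  (forall w, #|f w| <= 2) -> 5 * t <= #|W| ->
  exists2 I : {set V}, I \subset W & #|I| = t /\ {in I &, forall x y, x != y -> y \notin f x}.
Proof.
move=> f2; elim: t W => [|t IH] W tW.
  by exists set0; rewrite ?sub0set ?cards0; split=> // x y; rewrite inE.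
have [y yW ind] : exists2 y, y \in W & #|[set x in W | y \in f x]| <= 2.
  apply/exists_inP; apply: contraLR tW => /exists_inPn many; rewrite -ltnNge.
  have : 3 * #|W| <= 2 * #|W|; last by lia.
  rewrite [3 * _]mulnC [2 * _]mulnC -!sum_nat_const.
  apply: (@leq_trans (\sum_(y in W) \sum_(x in W) (y \in f x))).
    apply: leq_sum => y yW; have := many y yW; rewrite -ltnNge => /leq_trans; apply.
    by rewrite -sum1dep_card big_mkcondr.
  rewrite exchange_big /=; apply: leq_sum => x _; apply: leq_trans (f2 x).
  rewrite -sum1_card [X in _ <= X]big_mkcond [X in X <= _]big_mkcond /=.
  by apply: leq_sum => y _; case: ifP => //; case: (y \in f x).
pose W' := W :\: (y |: (f y :|: [set x in W | y \in f x])).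
have tW' : 5 * t <= #|W'|.
  have := cardsID (y |: (f y :|: [set x in W | y \in f x])) W; rewrite -/W'.
  have := subset_leq_card (subsetIr W (y |: (f y :|: [set x in W | y \in f x]))).
  rewrite cardsU1; have := leq_of_leqif (leq_card_setU (f y) [set x in W | y \in f x]).
  by move: (f2 y) ind (leq_b1 (y \notin f y :|: [set x in W | y \in f x])); lia.
have [I IW' [It indI]] := IH W' tW'.
have yI : y \notin I by apply: contraTN isT => /(subsetP IW'); rewrite !inE eqxx.
exists (y |: I).
  by apply/subsetP => x /setU1P[->|/(subsetP IW')] //; rewrite inE => /andP[].
split; first by rewrite cardsU1 yI It.
have nI x : x \in I -> (x \notin f y) && (y \notin f x).
  by move=> /(subsetP IW'); rewrite !inE !negb_or negb_and => /andP[/and3P[_ -> /orP[/negPf->|->]]].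
move=> a b /setU1P[->|aI] /setU1P[->|bI]; rewrite ?eqxx // => ab.
- by case/andP: (nI b bI).
- by case/andP: (nI a aI).
- exact: indI.
Qed.

(** Every candidate page comes with two hyperedges, whose third vertices may hit other pages. An
    independent set in this conflict digraph consists of pages with the correct traces. *)
Lemma few_pages (n t : nat) (H : {set {set 'I_n}}) (u v : 'I_n) :
  uniform3 H -> trB_free t H -> shadow H u v ->
  #|[set w | pair_avoiding H u w v && pair_avoiding H v w u]| <= 5 * t.
Proof.
move=> /forall_inP unif + /andP[uv /exists_inP[h0 h0H /andP[uh0 vh0]]].
apply: contraNT; rewrite -ltnNge; set D := [set w | _] => tD.
pose h1 w := odflt set0 [pick h in H | [&& u \in h, w \in h & v \notin h]].
pose h2 w := odflt set0 [pick h in H | [&& v \in h, w \in h & u \notin h]].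
have h1P w : w \in D -> [&& h1 w \in H, u \in h1 w, w \in h1 w & v \notin h1 w].
  rewrite inE => /andP[/exists_inP[h hH hw] _]; rewrite /h1.
  by case: pickP => [h' /andP[->]|/(_ h)] //=; rewrite hH hw.
have h2P w : w \in D -> [&& h2 w \in H, v \in h2 w, w \in h2 w & u \notin h2 w].
  rewrite inE => /andP[_ /exists_inP[h hH hw]]; rewrite /h2.
  by case: pickP => [h' /andP[->]|/(_ h)] //=; rewrite hH hw.
(* [f w] collects the third vertices of the two hyperedges chosen for [w]; the traces are spoilt
   only if one of them is another chosen page. *)
pose f w := if w \in D then (h1 w :\: [set u; w]) :|: (h2 w :\: [set v; w]) else set0.
have rest x w (h : {set 'I_n}) : h \in H -> x \in h -> w \in h -> x != w ->
    #|h :\: [set x; w]| = 1.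
  move=> /unif/eqP h3 xh wh xw.
  by rewrite cardsD (setIidPr _) ?h3 ?cards2 ?xw // subUset !sub1set xh wh.
have f2 w : #|f w| <= 2.
  rewrite /f; case: ifP => [wD|_]; last by rewrite cards0.
  have /and4P[H1 u1 w1 v1] := h1P w wD; have /and4P[H2 v2 w2 u2] := h2P w wD.
  apply: leq_trans (leq_of_leqif (leq_card_setU _ _)) _.
  rewrite (rest u w (h1 w)) ?(rest v w (h2 w)) //.
    by apply: contraNneq v1 => ->.
  by apply: contraNneq u2 => ->.
have uD : u \notin D.
  by apply/negP => /h2P/and4P[_ _ ->].
have vD : v \notin D.
  by apply/negP => /h1P/and4P[_ _ ->].
(* The strict inequality in [tD] pays for the one vertex that must be dropped, the third vertex of
   the hyperedge [h0] on the spine. *)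
have tD' : 5 * t <= #|D :\: h0|.
  rewrite cardsD; suff : #|D :&: h0| <= 1 by lia.
  rewrite -(rest u v h0) //; apply/subset_leq_card/subsetP => x.
  rewrite !inE negb_or => /andP[xD ->]; rewrite andbT; apply/andP; split.
    by apply: contraTneq xD => ->; rewrite inE in uD.
  by apply: contraTneq xD => ->; rewrite inE in vD.
have [I ID [It indI]] := sparse_digraph_independent f2 tD'.
pose w := [ffun i : 'I_t => enum_val (cast_ord (esym It) i)].
have wI i : w i \in I by rewrite ffunE enum_valP.
have imw : [set w i | i : 'I_t] = I.
  apply/setP => x; apply/imsetP/idP => [[i _ ->] //|xI].
  exists (cast_ord It (enum_rank_in xI x)) => //.
  by rewrite ffunE cast_ordK enum_rankK_in.
have ID' x : x \in I -> (x \in D) && (x \notin h0).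
  by move/(subsetP ID); rewrite in_setD andbC.
apply/existsP; exists u; apply/existsP; exists v; apply/existsP; exists w.
rewrite imw; set S := u |: (v |: I).
have uI : u \notin I by apply: contra uD => /ID'/andP[].
have vI : v \notin I by apply: contra vD => /ID'/andP[].
have fI x y : x \in I -> y \in I -> y \in f x -> y = x.
  move=> xI yI; apply: contraTeq => yx; apply: indI => //; by rewrite eq_sym.
rewrite uv uI vI /=; apply/and4P; split=> //.
- apply/injectiveP => i j; rewrite !ffunE => /enum_val_inj/(congr1 (cast_ord It)).
  by rewrite !cast_ordKV.
- apply/exists_inP; exists h0 => //; apply/eqP/setP => x; rewrite !inE.
  apply/andP/idP => [[xh /or3P[->|->|xI]]|]; rewrite ?orbT //.
    by case/andP: (ID' x xI) => _; rewrite xh.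
  by case/orP => /eqP ->; rewrite ?uh0 ?vh0 !eqxx ?orbT.
- apply/forallP => i; apply/exists_inP; have wD : w i \in D by case/andP: (ID' _ (wI i)).
  have /and4P[H1 u1 w1 v1] := h1P _ wD.
  exists (h1 (w i)) => //; apply/eqP/setP => x; rewrite !inE.
  apply/andP/idP => [[xh /or3P[->//|/eqP xv|xI]]|].
  + by move: v1; rewrite -xv xh.
  + have [->//|xu] := eqVneq x u; rewrite orFb.
    have [//|xw] := eqVneq x (w i).
    by move: (xw); rewrite (fI (w i) x) ?eqxx // /f wD !inE xh (negPf xu) (negPf xw).
  + by case/orP => /eqP ->; rewrite ?u1 ?w1 ?eqxx ?wI ?orbT.
- apply/forallP => i; apply/exists_inP; have wD : w i \in D by case/andP: (ID' _ (wI i)).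
  have /and4P[H2 v2 w2 u2] := h2P _ wD.
  exists (h2 (w i)) => //; apply/eqP/setP => x; rewrite !inE.
  apply/andP/idP => [[xh /or3P[/eqP xu|->//|xI]]|].
  + by move: u2; rewrite -xu xh.
  + have [->//|xv] := eqVneq x v; rewrite orFb.
    have [//|xw] := eqVneq x (w i).
    by move: (xw); rewrite (fI (w i) x) ?eqxx // /f wD !inE xh (negPf xv) (negPf xw) orbT.
  + by case/orP => /eqP ->; rewrite ?v2 ?w2 ?eqxx ?wI ?orbT.
Qed.

(** * Own pairs and full edges *)

Section OwnPairs.
Variables (V : finType) (H : {set {set V}}) (T : nat).
Hypothesis unif : forall h, h \in H -> #|h| = 3.
Hypothesis pages : forall u v, shadow H u v ->
  #|[set w | pair_avoiding H u w v && pair_avoiding H v w u]| <= T.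
Notation sh := (shadow H).

Definition codeg x y := #|[set h in H | (x \in h) && (y \in h)]|.
Definition thick : rel V := fun x y => (x != y) && (1 < codeg x y).
Definition full (e : {set V}) :=
  [forall x in e, forall y in e, (x != y) ==> (1 < codeg x y)].
Definition own_pair (e : {set V}) : option (V * V) :=
  [pick p | [&& p.1 \in e, p.2 \in e, p.1 != p.2 & codeg p.1 p.2 <= 1]].
(* Choosing a single pair of codegree one in each hyperedge is essential:
   [own_uniq] is what excludes shadow pairs inside the two large classes. *)
Definition own : rel V := fun x y =>
  [exists e in H, (own_pair e == Some (x, y)) || (own_pair e == Some (y, x))].
Definition covers x y z := [exists h in H, [&& x \in h, y \in h & z \in h]].

Lemma shadowP x y :
  reflect (x != y /\ exists2 h, h \in H & (x \in h) && (y \in h)) (sh x y).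
Proof. by apply: (iffP andP) => -[-> /exists_inP ?]; split=> //; apply/exists_inP. Qed.

Lemma shadow_sym : symmetric sh.
Proof.
by move=> x y; rewrite /shadow eq_sym; under eq_existsb => h do rewrite [(x \in h) && _]andbC.
Qed.

Lemma mem_shadow h x y : h \in H -> x \in h -> y \in h -> x != y -> sh x y.
Proof. by move=> hH xh yh xy; apply/shadowP; split=> //; exists h; rewrite ?xh. Qed.

Lemma codeg_sym x y : codeg x y = codeg y x.
Proof. by apply: eq_card => h; rewrite !inE andbA andbAC -andbA. Qed.

Lemma thick_sym : symmetric thick.
Proof. by move=> x y; rewrite /thick codeg_sym eq_sym. Qed.

Lemma edge_third h x y : h \in H -> x \in h -> y \in h -> x != y ->
  exists z, [/\ h = [set x; y; z], z != x & z != y].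
Proof.
move=> /unif h3 xh yh xy; have : #|h :\: [set x; y]| == 1.
  by rewrite cardsD (setIidPr _) ?h3 ?cards2 ?xy // subUset !sub1set xh yh.
case/cards1P => z zE; exists z.
have : z \in h :\: [set x; y] by rewrite zE set11.
rewrite !inE negb_or => /andP[/andP[-> ->] _]; split=> //.
rewrite -zE -setUA; apply/setP => w; rewrite !inE.
by case: eqP => [->|_] //=; case: eqP => [->|_].
Qed.

Lemma edge_eq h x y z : h \in H -> x \in h -> y \in h -> z \in h ->
  x != y -> z != x -> z != y -> h = [set x; y; z].
Proof.
move=> hH xh yh zh xy zx zy; have [w [hE _ _]] := edge_third hH xh yh xy.
by move: zh; rewrite hE !inE (negPf zx) (negPf zy) => /eqP ->.
Qed.

Lemma own_sym : symmetric own.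
Proof. by move=> x y; apply: eq_existsb => e; rewrite [X in _ && X]orbC. Qed.

Lemma ownP x y : own x y ->
  exists e, [/\ e \in H, (x \in e) && (y \in e), x != y,
    (forall h, h \in H -> x \in h -> y \in h -> h = e) &
    own_pair e = Some (x, y) \/ own_pair e = Some (y, x)].
Proof.
case/exists_inP => e eH ope; exists e.
have [xe ye xy cxy] : [/\ x \in e, y \in e, x != y & codeg x y <= 1].
  move: ope; rewrite /own_pair; case: pickP => //= -[a b] /= /and4P[ae be ab cab].
  by case/orP => /eqP[<- <-]; split=> //; rewrite 1?eq_sym 1?codeg_sym.
rewrite xe ye; split=> //; last by case/orP: ope => /eqP; [left|right].
move=> h hH xh yh; apply/eqP.
move: cxy; rewrite /codeg => /card_le1P/(_ e); rewrite inE eH xe ye => /(_ isT).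
by move/(_ h); rewrite !inE hH xh yh => /esym.
Qed.

Lemma own_shadow x y : own x y -> sh x y.
Proof. by case/ownP => e [eH /andP[xe ye] xy _ _]; exact: (mem_shadow eH xe ye). Qed.

Lemma own_codeg x y : own x y -> codeg x y <= 1.
Proof.
case/ownP => e [_ _ _ uni _]; apply/card_le1P => h.
rewrite inE => /and3P[hH xh yh] h'; rewrite !inE; apply/and3P/eqP => [[h'H xh' yh']|->] //.
by rewrite (uni h) // (uni h').
Qed.

Lemma own_pair_mem e x y : own_pair e = Some (x, y) -> x \in e /\ y \in e.
Proof. by rewrite /own_pair; case: pickP => // -[a b] /and4P[ae be _ _] [<- <-]. Qed.

(** A hyperedge through [x], [y] and [b] would be the only one on both [xb] and [yb], and would then
    have chosen two different own pairs. *)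
Lemma own_uniq x y b : x != y -> own x b -> own y b -> ~~ covers x y b.
Proof.
move=> xy /ownP[e [_ _ xb uni ox]] /ownP[e' [_ _ yb uni' oy]].
apply/negP => /exists_inP[h hH /and3P[xh yh bh]].
have ee : e = e' by rewrite -(uni h) // -(uni' h).
rewrite -ee in oy; move: xy xb yb.
case: ox oy => -> [] [].
- by move=> ->; rewrite eqxx.
- by move=> -> ->; rewrite eqxx.
- by move=> -> ->; rewrite eqxx.
- by move=> ->; rewrite eqxx.
Qed.

Lemma shadow_avoiding_or_covers x y z : sh x y ->
  pair_avoiding H x y z \/ covers x y z.
Proof.
case/shadowP => xy [h hH /andP[xh yh]]; case zh: (z \in h).
  by right; apply/exists_inP; exists h; rewrite ?xh ?yh.
by left; apply/exists_inP; exists h; rewrite ?xh ?yh ?zh.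
Qed.

(** The only hyperedge on [uv] has a single third vertex, which accounts for the extra 1; every
    other common shadow neighbour is a page for [uv]. *)
Lemma own_few_triangles u v : own u v -> #|[set w | sh u w && sh v w]| <= T.+1.
Proof.
move=> uv; have [e [eH /andP[ue ve] neq uni _]] := ownP uv.
have [c [eE cu cv]] := edge_third eH ue ve neq.
apply: leq_trans (_ : #|c |: [set w | pair_avoiding H u w v && pair_avoiding H v w u]| <= _).
  apply/subset_leq_card/subsetP => w; rewrite !inE => /andP[uw vw].
  have wuv : covers u v w -> w = c.
    case/exists_inP => h hH /and3P[uh vh wh]; move: wh; rewrite (uni h) // eE !inE.
    have /shadowP[nuw _] := uw; have /shadowP[nvw _] := vw.
    by rewrite !(eq_sym w) (negPf nuw) (negPf nvw) => /eqP.
  case: (shadow_avoiding_or_covers v uw) => [->|c1].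
    case: (shadow_avoiding_or_covers u vw) => [->|c1]; first by rewrite orbT.
    rewrite wuv ?eqxx //; case/exists_inP: c1 => h hH /and3P[*].
    by apply/exists_inP; exists h => //; apply/and3P.
  rewrite wuv ?eqxx //; case/exists_inP: c1 => h hH /and3P[*].
  by apply/exists_inP; exists h => //; apply/and3P.
rewrite cardsU1 -add1n leq_add ?leq_b1 //; apply: pages; exact: own_shadow.
Qed.

Lemma own_avoiding x b y : own x b -> ~~ covers x b y -> pair_avoiding H x b y.
Proof. by move=> /own_shadow/(shadow_avoiding_or_covers y)[|->]. Qed.

Lemma covers_swap x y z : covers x y z = covers x z y.
Proof. by apply: eq_existsb => h; congr (_ && _); rewrite [(y \in h) && _]andbC. Qed.

Lemma covers_rot x y z : covers x y z = covers y x z.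
Proof. by apply: eq_existsb => h; congr (_ && _); rewrite andbCA. Qed.

(** By [own_uniq] no hyperedge contains [x], [y] and a common own neighbour, so all common own
    neighbours are pages. *)
Lemma few_common_own x y : sh x y -> #|[set w | own x w && own y w]| <= T.
Proof.
move=> xy; apply: leq_trans (pages xy); apply/subset_leq_card/subsetP => w.
rewrite !inE => /andP[xw yw]; have /shadowP[neq _] := xy.
rewrite !own_avoiding //.
  by rewrite covers_swap own_uniq // eq_sym.
by rewrite covers_swap own_uniq.
Qed.

(** Call the third vertex of the unique hyperedge on an own pair its colour. If [ab] has a colour
    other than [z], its hyperedge avoids [z] and some hyperedge on [zb] avoids [a], so [b] is a page
    for [az]. *)
Lemma few_miscoloured a z : sh a z ->
  #|[set b | [&& sh z b, own a b & ~~ covers a b z]]| <= T.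
Proof.
move=> az; apply: leq_trans (pages az); apply/subset_leq_card/subsetP => b.
rewrite !inE => /and3P[zb ab nc]; rewrite own_avoiding //.
case: (shadow_avoiding_or_covers a zb) => // c.
by rewrite covers_swap covers_rot covers_swap c in nc.
Qed.

(** By 3-uniformity, at most one of two hyperedges on [uw] contains [v]. *)
Lemma thick_avoiding u w v : thick u w -> v != u -> v != w -> pair_avoiding H u w v.
Proof.
case/andP => uw /card_gt1P[h1 [h2 [+ + h12]]] vu vw.
rewrite !inE => /and3P[h1H u1 w1] /and3P[h2H u2 w2].
case v1: (v \in h1); last by apply/exists_inP; exists h1; rewrite ?u1 ?w1 ?v1.
apply/exists_inP; exists h2; rewrite ?u2 ?w2 //=; apply: contra h12 => v2.
by rewrite (edge_eq h1H u1 w1 v1 uw) // (edge_eq h2H u2 w2 v2 uw).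
Qed.

Lemma few_thick u v : sh u v -> #|[set w | thick u w && thick v w]| <= T.
Proof.
move=> uv; apply: leq_trans (pages uv); apply/subset_leq_card/subsetP => w.
have /shadowP[neq _] := uv.
rewrite !inE => /andP[uw vw]; rewrite !thick_avoiding //.
- by case/andP: uw.
- by rewrite eq_sym.
- by case/andP: vw.
Qed.

Lemma thick_shadow x y : thick x y -> sh x y.
Proof.
case/andP => xy /ltnW/card_gt0P[h]; rewrite inE => /and3P[hH xh yh].
exact: (mem_shadow hH).
Qed.

Lemma full_thick e x y : full e -> x \in e -> y \in e -> x != y -> thick x y.
Proof.
by move=> /forall_inP fe xe ye xy; move/forall_inP: (fe x xe) => /(_ y ye); rewrite /thick xy.
Qed.

Definition full_edges := [set e in H | full e].

Lemma card_full_edges : #|full_edges| <= #|triangles thick|.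
Proof.
apply: leq_trans (leq_imset_card (fun p : V * V * V => [set p.1.1; p.1.2; p.2]) _).
apply/subset_leq_card/subsetP => e; rewrite inE => /andP[eH fe].
have /card_gt1P[x [y [xe ye xy]]] : 1 < #|e| by rewrite unif.
have [z [eE zx zy]] := edge_third eH xe ye xy.
have ze : z \in e by rewrite eE !inE eqxx !orbT.
apply/imsetP; exists (x, y, z) => //; rewrite inE /=.
by rewrite !(full_thick fe) // 1?eq_sym.
Qed.

Lemma few_full_edges x y : x != y ->
  #|[set e in full_edges | (x \in e) && (y \in e)]| <= T.
Proof.
move=> xy; case: (set_0Vmem [set e in full_edges | (x \in e) && (y \in e)]) => [->|[e0]].
  by rewrite cards0.
rewrite !inE => /andP[/andP[e0H _] /andP[xe0 ye0]].
apply: leq_trans (few_thick (mem_shadow e0H xe0 ye0 xy)).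
apply: leq_trans (leq_imset_card (fun z => [set x; y; z]) _).
apply/subset_leq_card/subsetP => e; rewrite !inE => /andP[/andP[eH fe] /andP[xe ye]].
have [z [eE zx zy]] := edge_third eH xe ye xy.
have ze : z \in e by rewrite eE !inE eqxx !orbT.
by apply/imsetP; exists z => //; rewrite inE !(full_thick fe) // eq_sym.
Qed.

(** A pair of codegree one identifies its hyperedge, so distinct non-full hyperedges have distinct
    own pairs; the factor 2 counts the two orientations. *)
Lemma card_nonfull_edges :
  (#|H| - #|full_edges|) * 2 <= #|[set p | own p.1 p.2]|.
Proof.
have defined e : e \in H -> ~~ full e -> exists p, own_pair e = Some p.
  move=> eH; rewrite /own_pair; case: pickP => [p _ _|no /negP[]]; first by exists p.
  apply/forall_inP => x xe; apply/forall_inP => y ye; apply/implyP => xy.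
  by move: (no (x, y)); rewrite /= xe ye xy /= ltnNge => ->.
have [e0 e0H|H0] := pickP (mem H); last by rewrite (eq_card0 H0).
have /card_gt0P[v0 _] : 0 < #|e0| by rewrite unif.
(* The boolean selects the orientation; [(v0, v0)] is a mere default, since every non-full hyperedge
   has an own pair. *)
pose f (q : {set V} * bool) := let p := odflt (v0, v0) (own_pair q.1) in
  if q.2 then p else (p.2, p.1).
have -> : (#|H| - #|full_edges|) * 2 = #|setX (H :\: full_edges) [set: bool]|.
  by rewrite cardsX cardsT card_bool cardsD (setIidPr _) //; apply/subsetP => e; rewrite inE => /andP[].
have owned e p : e \in H -> own_pair e = Some p -> own p.1 p.2.
  by case: p => x y eH ope; apply/exists_inP; exists e; rewrite // ope eqxx.
rewrite -(card_in_imset (f := f)); last first.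
  move=> [e b] [e' b']; rewrite !inE /= !andbT.
  move=> /andP[ne eH] /andP[ne' eH']; rewrite eH /= in ne; rewrite eH' /= in ne'.
  have [[x y] ope] := defined e eH ne; have [[x' y'] ope'] := defined e' eH' ne'.
  have [xe ye] := own_pair_mem ope; have [xe' ye'] := own_pair_mem ope'.
  have [e1 [_ _ xy uni _]] := ownP (owned e (x, y) eH ope).
  rewrite /f ope ope' /= => fE.
  have ee : e' = e.
    rewrite [RHS]uni // (uni e') //.
      by case: (b) (b') fE => -[] [-> ->].
    by case: (b) (b') fE => -[] [-> ->].
  move: ope'; rewrite ee ope => -[xx yy]; move: fE; rewrite -xx -yy.
  by case: (b) (b') => -[] // [h]; rewrite h eqxx in xy.
apply/subset_leq_card/subsetP => _ /imsetP[[e b] + ->]; rewrite !inE /= andbT /f.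
case/andP=> ne eH; rewrite eH /= in ne; have [[x y] ope] := defined e eH ne.
by have := owned e _ eH ope; rewrite ope; case: b => //=; rewrite own_sym.
Qed.

End OwnPairs.

(** * Stability of the own-pair graph *)

Local Open Scope ring_scope.

Lemma card_rel (V W : finType) (R : V -> W -> bool) :
  #|[set p : V * W | R p.1 p.2]| = (\sum_x #|[set y | R x y]|)%N.
Proof.
rewrite -sum1dep_card -(pair_big_dep xpredT R (fun _ _ => 1%N)) /=.
by apply: eq_bigr => x _; rewrite sum1dep_card.
Qed.

Section Stability.
Variables (V : finType) (G : rel V) (T : nat).
Hypothesis G_sym : symmetric G.
Hypothesis few_common : forall x y, G x y -> (#|[set z | G x z && G y z]| <= T)%N.
Let n : rat := #|V|%:R.
Let d x : rat := #|[set y | G x y]|%:R.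
Let P : rat := #|[set p | G p.1 p.2]|%:R.

Lemma sum_degrees : \sum_x d x = P.
Proof. by rewrite /P card_rel natr_sum. Qed.

(** Averaging: summed over ordered edges, [d u + d v] gives twice the sum of the squared degrees,
    which is at least [2 * P ^+ 2 / n] by convexity. *)
Lemma edge_of_large_degrees (c : rat) : 0 < P -> c * n ^+ 2 < 2 * P ->
  exists u v, G u v /\ c * n <= d u + d v.
Proof.
move=> P0 cP; have n0 : 0 < n.
  rewrite /n ltr0n lt0n; apply: contraTneq P0 => V0; rewrite -sum_degrees big1 ?ltxx //.
  by move=> x; move: (fintype0 x V0).
have [/existsP[[u v] /andP[/= uv le]]|no] :=
    boolP [exists p : V * V, G p.1 p.2 && (c * n <= d p.1 + d p.2)].
  by exists u, v.
exfalso; move: no; rewrite negb_exists => /forallP no.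
pose S := \sum_x d x ^+ 2.
have up : 2 * S <= c * n * P.
  have E1 : \sum_x \sum_(y | G x y) d x = S.
    by apply: eq_bigr => x _; rewrite sum_const_set expr2.
  have E2 : \sum_x \sum_(y | G x y) d y = S.
    rewrite -[RHS]E1 (exchange_big_dep xpredT) //=.
    by apply: eq_bigr => x _; apply: eq_bigl => y; rewrite G_sym.
  have -> : 2 * S = \sum_x \sum_(y | G x y) (d x + d y).
    rewrite mulr_natl mulr2n -[X in X + _]E1 -[X in _ + X]E2 -big_split.
    by apply: eq_bigr => x _; rewrite -big_split.
  rewrite -sum_degrees mulr_sumr; apply: ler_sum => x _.
  rewrite mulrC -sum_const_set; apply: ler_sum => y xy.
  by have := no (x, y); rewrite /= xy /= -ltNge => /ltW.
have low : P ^+ 2 <= n * S.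
  have : 0 <= \sum_x (d x - P / n) ^+ 2 by apply: sumr_ge0 => x _; apply: sqr_ge0.
  have -> : \sum_x (d x - P / n) ^+ 2 = S - P ^+ 2 / n.
    have -> : \sum_x (d x - P / n) ^+ 2 =
        \sum_x (d x ^+ 2 - 2 * (P / n) * d x + (P / n) ^+ 2).
      by apply: eq_bigr => x _; ring.
    rewrite big_split sumrB /= -mulr_sumr sum_degrees sum_const_set cardsT -/S.
    by field; rewrite lt0r_neq0.
  by rewrite subr_ge0 ler_pdivrMr // mulrC.
have : 2 * P ^+ 2 <= c * n ^+ 2 * P.
  apply: (@le_trans _ _ (n * (2 * S))); first by lra.
  by have -> : c * n ^+ 2 * P = n * (c * n * P); [ring | rewrite (ler_pM2l n0)].
rewrite expr2 mulrA ler_pM2r // leNgt.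
by rewrite cP.
Qed.

Let adj x (A : {set V}) : rat := #|[set y in A | G x y]|%:R.

(* The classes come from an edge [uv] with [d u + d v] nearly [n]: they are
   [N v] and [N u \ N v], and a neighbourhood spans few edges. *)
Lemma stability (eta : rat) : 0 < eta -> eta <= 1 / 10 ->
  2 * T%:R <= eta ^+ 2 / 100 * n -> 0 < n ->
  (1 / 2 - eta ^+ 2 / 100) * n ^+ 2 <= P ->
  exists A B : {set V}, [/\ [disjoint A & B], #|~: (A :|: B)|%:R <= eta * n,
    forall a, a \in A -> #|[set b in B | ~~ G a b]|%:R <= eta * n,
    forall b, b \in B -> #|[set a in A | ~~ G b a]|%:R <= eta * n &
    n / 5 <= #|A|%:R /\ n / 5 <= #|B|%:R].
Proof.
move=> eta0 eta1 Tn n0 PP.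
(* The deficit is quadratic in [eta] because the Markov argument in [typical] divides by
   [eta / 4]. *)
pose dl : rat := eta ^+ 2 / 100.
have dl0 : 0 < dl by rewrite divr_gt0 // exprn_gt0.
have dle : dl * 1000 <= eta by rewrite /dl expr2; nra.
rewrite -/dl in Tn PP.
have dn0 : 0 < dl * n by rewrite mulr_gt0.
have n2 : 0 < n ^+ 2 := exprn_gt0 2 n0.
have dn2 : 0 < dl * n ^+ 2 := mulr_gt0 dl0 n2.
have P0 : 0 < P by apply: lt_le_trans PP; apply: mulr_gt0 n2; move: dle eta1; lra.
have [u [v [uv duv]]] : exists u v, G u v /\ (1 - 4 * dl) * n <= d u + d v.
  by apply: edge_of_large_degrees P0 _; move: n2 dn2 PP; lra.
pose A := [set y | G v y]; pose B := [set y | G u y] :\: A.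
have AB : [disjoint A & B] by rewrite -setI_eq0 setIDA setDIl setDv set0I.
pose R := ~: (A :|: B).
have few_in (A0 : {set V}) w x : G w x -> {subset A0 <= [set y | G w y]} -> adj x A0 <= T%:R.
  move=> wx sub; rewrite ler_nat; apply: leq_trans (few_common wx).
  apply/subset_leq_card/subsetP => y; rewrite !inE => /andP[/sub]; rewrite inE.
  by move=> -> ->.
have sizes : #|A|%:R + #|B|%:R + #|R|%:R = n :> rat.
  by rewrite -!natrD /n -(cardsUI A B) disjoint_setI0 // cards0 addn0 cardsC.
have nR : #|R|%:R <= 5 * dl * n.
  have : #|[set y | G u y]|%:R <= #|B|%:R + T%:R :> rat.
    rewrite -natrD ler_nat -(cardsID A) addnC leq_add2l.
    apply: leq_trans (few_common uv); apply/subset_leq_card/subsetP => y.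
    by rewrite !inE.
  move: duv; rewrite /d -/A; lra.
have split_adj x A1 B1 : adj x (A1 :|: B1) <= adj x A1 + adj x B1.
  rewrite -natrD ler_nat; apply: leq_trans (leq_of_leqif (leq_card_setU _ _)).
  by apply/subset_leq_card/subsetP => y; rewrite !inE andb_orl.
have adj_le x A1 : adj x A1 <= #|A1|%:R.
  by rewrite ler_nat; apply/subset_leq_card/subsetP => y; rewrite inE => /andP[].
have dE x : d x <= adj x A + adj x B + #|R|%:R.
  apply: le_trans (_ : adj x (A :|: B :|: R) <= _).
    rewrite ler_nat; apply/subset_leq_card/subsetP => y.
    by rewrite !inE /= orbN => ->.
  apply: le_trans (split_adj _ _ _) _; apply: lerD; [exact: split_adj|exact: adj_le].
pose E := \sum_(x in A) adj x B.
have EE : E = \sum_(x in B) adj x A.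
  have aE x A1 : adj x A1 = \sum_(y in A1) (G x y)%:R.
    rewrite /adj -sum_indicator [RHS]big_mkcond; apply: eq_bigr => y _.
    by case: (y \in A1).
  rewrite /E (eq_bigr _ (fun x _ => aE x B)) [RHS](eq_bigr _ (fun x _ => aE x A)).
  by rewrite exchange_big /=; apply: eq_bigr => x _; apply: eq_bigr => y _; rewrite G_sym.
have sumA : \sum_(x in A) d x <= E + #|A|%:R * (T%:R + #|R|%:R).
  have -> : #|A|%:R * (T%:R + #|R|%:R) = \sum_(x in A) (T%:R + #|R|%:R) :> rat.
    by rewrite sum_const_set cardsE.
  rewrite -big_split; apply: ler_sum => x xA /=.
  have : adj x A <= T%:R by apply: (few_in _ v) => //; rewrite inE in xA.
  by have := dE x; lra.
have sumB : \sum_(x in B) d x <= E + #|B|%:R * (T%:R + #|R|%:R).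
  have -> : #|B|%:R * (T%:R + #|R|%:R) = \sum_(x in B) (T%:R + #|R|%:R) :> rat.
    by rewrite sum_const_set cardsE.
  rewrite EE -big_split; apply: ler_sum => x xB /=.
  have : adj x B <= T%:R.
    apply: (few_in _ u); first by move: xB; rewrite !inE => /andP[].
    by move=> y; rewrite !inE => /andP[].
  by have := dE x; lra.
have sumR : \sum_(x in R) d x <= #|R|%:R * n.
  have -> : #|R|%:R * n = \sum_(x in R) n by rewrite sum_const_set cardsE.
  by apply: ler_sum => x _; rewrite /n ler_nat max_card.
have PE : P = \sum_(x in A) d x + \sum_(x in B) d x + \sum_(x in R) d x.
  rewrite -sum_degrees (bigID (mem (A :|: B))) /= ; congr (_ + _); last first.
    by apply: eq_bigl => x; rewrite in_setC.
  rewrite (eq_bigl [predU A & B]); last by move=> x; rewrite !inE.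
  by rewrite bigU.
have sAB : #|A|%:R * #|B|%:R <= n ^+ 2 / 4 :> rat.
  have := sqr_ge0 (#|A|%:R - #|B|%:R : rat).
  have : (#|A|%:R + #|B|%:R) ^+ 2 <= n ^+ 2 :> rat.
    rewrite ler_pXn2r ?nnegrE ?addr_ge0 // -sizes lerDl //.
  by rewrite !expr2; lra.
(* [P] counts ordered pairs: those between the classes twice, a few inside the classes, and those
   meeting [R]. *)
have PlE : P <= 2 * E + n * T%:R + 2 * #|R|%:R * n.
  have R0 : 0 <= (#|R|%:R : rat) ^+ 2 := sqr_ge0 _.
  have RT0 : 0 <= #|R|%:R * T%:R :> rat by rewrite mulr_ge0.
  rewrite PE; move: sumA sumB sumR R0 RT0; rewrite -sizes expr2; lra.
have nT : n * T%:R <= dl / 2 * n ^+ 2.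
  by have := ler_wpM2r (ltW n0) Tn; lra.
have RN : #|R|%:R * n <= 5 * dl * n ^+ 2.
  by have := ler_wpM2r (ltW n0) nR; lra.
have Elow : (1 / 4 - 6 * dl) * n ^+ 2 <= E by lra.
have miss : #|A|%:R * #|B|%:R - E <= 6 * dl * n ^+ 2 by lra.
(* Markov's inequality: few pairs between the classes are missing, so few vertices miss more than
   [eta / 4 * n] partners. *)
have typical (X Y : {set V}) : #|X|%:R * #|Y|%:R - \sum_(x in X) adj x Y <= 6 * dl * n ^+ 2 ->
    #|[set x in X | ~~ (#|[set y in Y | ~~ G x y]|%:R <= eta / 4 * n)]|%:R <= eta / 4 * n.
  move=> XY; set X' := [set x in X | _].
  have : #|X'|%:R * (eta / 4 * n) <= 6 * dl * n ^+ 2.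
    apply: le_trans XY.
    have -> : #|X|%:R * #|Y|%:R - \sum_(x in X) adj x Y =
        \sum_(x in X) (#|[set y in Y | ~~ G x y]|%:R : rat).
      have -> : #|X|%:R * #|Y|%:R = \sum_(x in X) (#|Y|%:R : rat).
        by rewrite sum_const_set cardsE.
      rewrite -sumrB; apply: eq_bigr => x _; rewrite /adj -(cardsID [set y | G x y] Y).
      rewrite natrD [X in X + _ - _](_ : _ = adj x Y); last first.
        by congr (_%:R); apply: eq_card => y; rewrite !inE.
      rewrite addrAC subrr add0r; congr (_%:R).
      by apply: eq_card => y; rewrite !inE andbC.
    have -> : #|X'|%:R * (eta / 4 * n) = \sum_(x in X') (eta / 4 * n).
      by rewrite sum_const_set cardsE.
    rewrite big_mkcond [leRHS]big_mkcond; apply: ler_sum => x _; rewrite inE.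
    by case: (x \in X) => //=; case: (lerP _ (eta / 4 * n)) => //= /ltW.
  have pos : 0 < eta / 4 * n by rewrite mulr_gt0 // divr_gt0.
  move=> le; rewrite -(ler_pM2r pos); apply: le_trans le _.
  have : 0 <= eta ^+ 2 * n ^+ 2 by rewrite mulr_ge0 ?sqr_ge0.
  by rewrite /dl; lra.
pose A' := [set x in A | #|[set y in B | ~~ G x y]|%:R <= eta / 4 * n].
pose B' := [set x in B | #|[set y in A | ~~ G x y]|%:R <= eta / 4 * n].
have cA : #|A|%:R <= #|A'|%:R + eta / 4 * n.
  rewrite -(cardsID [set x | #|[set y in B | ~~ G x y]|%:R <= eta / 4 * n] A) natrD.
  apply: lerD; first by rewrite ler_nat; apply/subset_leq_card/subsetP => x; rewrite !inE.
  apply: le_trans (typical A B miss); rewrite ler_nat; apply/subset_leq_card/subsetP => x.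
  by rewrite !inE andbC.
have cB : #|B|%:R <= #|B'|%:R + eta / 4 * n.
  rewrite -(cardsID [set x | #|[set y in A | ~~ G x y]|%:R <= eta / 4 * n] B) natrD.
  apply: lerD; first by rewrite ler_nat; apply/subset_leq_card/subsetP => x; rewrite !inE.
  have := typical B A; rewrite -EE [#|B|%:R * _]mulrC => /(_ miss); apply: le_trans.
  rewrite ler_nat; apply/subset_leq_card/subsetP => x.
  by rewrite !inE andbC.
have sA : A' \subset A by apply/subsetP => x; rewrite inE => /andP[].
have sB : B' \subset B by apply/subsetP => x; rewrite inE => /andP[].
have A'B' : [disjoint A' & B'] by apply: disjointWl sA _; apply: disjointWr sB _.
have en0 : 0 < eta * n by rewrite mulr_gt0.
have dln : dl * n * 1000 <= eta * n by rewrite mulrAC ler_pM2r.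
(* No class can be small, because [E] is at most its size times [n]. *)
have large (X Y X' : {set V}) : E <= #|X|%:R * #|Y|%:R -> #|X|%:R <= #|X'|%:R + eta / 4 * n ->
    n / 5 <= #|X'|%:R.
  move=> EXY XX'; have Yn : #|Y|%:R <= n by rewrite /n ler_nat max_card.
  have : (1 / 4 - 6 * dl) * n <= #|X|%:R.
    rewrite -(ler_pM2r n0) -mulrA -expr2; apply: le_trans Elow _; apply: le_trans EXY _.
    by rewrite ler_wpM2l.
  have : eta * n <= 1 / 10 * n by rewrite ler_pM2r.
  by lra.
have EAB : E <= #|A|%:R * #|B|%:R.
  have -> : #|A|%:R * #|B|%:R = \sum_(x in A) (#|B|%:R : rat).
    by rewrite sum_const_set cardsE.
  by apply: ler_sum => x _; apply: adj_le.
exists A', B'; split=> //.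
- have : #|A'|%:R + #|B'|%:R + #|~: (A' :|: B')|%:R = n :> rat.
    by rewrite -!natrD /n -(cardsUI A' B') disjoint_setI0 // cards0 addn0 cardsC.
  by lra.
- move=> a; rewrite inE => /andP[_ le]; apply: (@le_trans _ _ (eta / 4 * n)); last by lra.
  apply: le_trans le; rewrite ler_nat; apply/subset_leq_card/subsetP => x.
  by rewrite !inE => /andP[/andP[-> _] ->].
- move=> a; rewrite inE => /andP[_ le]; apply: (@le_trans _ _ (eta / 4 * n)); last by lra.
  apply: le_trans le; rewrite ler_nat; apply/subset_leq_card/subsetP => x.
  by rewrite !inE => /andP[/andP[-> _] ->].
- split; first exact: large EAB cA.
  by apply: large cB; rewrite mulrC; exact: EAB.
Qed.
End Stability.

Local Close Scope ring_scope.

(** * Counting around the two large classes *)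

Local Open Scope ring_scope.

(** Double counting of the incidences between [X] and [S]. *)
Lemma card_rel_bound (P D : finType) (X : {set P}) (S : {set D}) (R : P -> D -> bool) (k : rat) :
  (forall e, e \in X -> exists2 p, p \in S & R e p) ->
  (forall p, p \in S -> #|[set e in X | R e p]|%:R <= k) -> #|X|%:R <= k * #|S|%:R.
Proof.
move=> XS Sk; have -> : k * #|S|%:R = \sum_(p in S) k.
  by rewrite sum_const_set cardsE mulrC.
apply: (@le_trans _ _ (\sum_(p in S) #|[set e in X | R e p]|%:R)); last exact: ler_sum.
rewrite -natr_sum ler_nat -sum1_card.
apply: (@leq_trans (\sum_(e in X) \sum_(p in S) R e p)%N).
  by apply: leq_sum => e /XS[p pS ep]; rewrite (bigD1 p) //= ep.
by rewrite exchange_big; apply: leq_sum => p _; rewrite -sum1dep_card big_mkcondr.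
Qed.

Section Counting.
Variables (V : finType) (H : {set {set V}}) (T : nat).
Hypothesis unif : forall h, h \in H -> #|h| = 3%N.
Hypothesis pages : forall u v, shadow H u v ->
  (#|[set w | pair_avoiding H u w v && pair_avoiding H v w u]| <= T)%N.
Notation sh := (shadow H).
Notation G := (own H).
Notation F := (full_edges H).
Let n : rat := #|V|%:R.
Let d x : rat := #|[set y | G x y]|%:R.

(** The constants form a hierarchy: [beta] is small against [1 / (T + 1)], [eta] against
    [beta ^+ 4 / (T + 1)], and [n] is large in terms of [eta]. The fourth power absorbs the squared
    number of centres, which is at most [4 / beta ^+ 4]. *)
Variables (eta beta : rat) (A0 B0 : {set V}).
Hypothesis eta0 : 0 < eta.
Hypothesis beta0 : 0 < beta.
Hypothesis betaT : beta * (1000 * 100 * (T%:R + 1)) <= 1.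
Hypothesis etaT : eta * (1000 * 1000 * (T%:R + 1)) <= beta ^+ 4.
Hypothesis n_large : 4 * (T%:R + 1) <= eta * n.
Hypothesis disj0 : [disjoint A0 & B0].
Hypothesis rest0 : #|~: (A0 :|: B0)|%:R <= eta * n.
Hypothesis missA : forall a, a \in A0 -> #|[set b in B0 | ~~ G a b]|%:R <= eta * n.
Hypothesis missB : forall b, b \in B0 -> #|[set a in A0 | ~~ G b a]|%:R <= eta * n.
Hypothesis largeA : n / 5 <= #|A0|%:R.
Hypothesis largeB : n / 5 <= #|B0|%:R.

Let T0 : 0 <= T%:R :> rat. Proof. by []. Qed.

Let n_gt0 : 0 < n.
Proof. by rewrite -(pmulr_rgt0 _ eta0); apply: lt_le_trans n_large; move: T0; lra. Qed.

Let beta_small : beta * 1000 * 100 <= 1.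
Proof. by have := mulr_ge0 (ltW beta0) T0; move: betaT; lra. Qed.

Let eta_beta : eta * 1000 * 1000 <= beta.
Proof.
have := mulr_ge0 (ltW eta0) T0; have : beta ^+ 4 <= beta.
  have b1 : beta <= 1 by move: beta_small beta0; lra.
  by rewrite -[leRHS]expr1 ler_wiXn2l // ltW.
by move: etaT; lra.
Qed.

Let en0 : 0 < eta * n. Proof. by rewrite mulr_gt0. Qed.
Let eta_n : eta * n * 1000 * 1000 <= beta * n.
Proof. by have := ler_wpM2r (ltW n_gt0) eta_beta; lra. Qed.
Let beta_n : beta * n * 1000 * 100 <= n.
Proof. by have := ler_wpM2r (ltW n_gt0) beta_small; lra. Qed.

(* The threshold [n / 100] is much weaker than the bound [eta * n] for [A0] and
   [B0]: a vertex outside both sides therefore has of order [n] fewer own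
   neighbours than a vertex inside, which dominates all other error terms. *)
Definition side (Y : {set V}) : {set V} :=
  [set x | #|[set y in Y | ~~ G x y]|%:R <= n / 100].
Let A := side B0.
Let B := side A0.
Let Z := ~: (A :|: B).
Let U := ~: (A0 :|: B0).

Let subA : A0 \subset A.
Proof.
apply/subsetP => a /missA; rewrite inE => /le_trans; apply.
by move: eta_n beta_n n_gt0; lra.
Qed.
Let subB : B0 \subset B.
Proof.
apply/subsetP => a /missB; rewrite inE => /le_trans; apply.
by move: eta_n beta_n n_gt0; lra.
Qed.

Lemma common_own (Y : {set V}) x y :
  #|Y|%:R <= #|[set z in Y | G x z && G y z]|%:R
    + #|[set z in Y | ~~ G x z]|%:R + #|[set z in Y | ~~ G y z]|%:R :> rat.
Proof.
rewrite -!natrD ler_nat.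
apply: leq_trans (leq_add (leq_of_leqif (leq_card_setU _ _)) (leqnn _)).
apply: leq_trans (leq_of_leqif (leq_card_setU _ _)).
apply/subset_leq_card/subsetP => z zY; rewrite !inE zY /=.
by case: (G x z); case: (G y z).
Qed.

Lemma own_nbr (Y : {set V}) x : n / 5 <= #|Y|%:R -> x \in side Y ->
  exists2 y, y \in Y & G x y.
Proof.
move=> Yn; rewrite inE => xY; apply/exists_inP; apply: contraTT xY => /exists_inPn no.
rewrite -ltNge; have -> : [set y in Y | ~~ G x y] = Y.
  by apply/setP => y; rewrite inE; case yY: (y \in Y) => //=; rewrite no.
by apply: lt_le_trans Yn; move: n_gt0; lra.
Qed.

(** A vertex [x] on both sides has an own neighbour [a] in [A0], and both [x] and [a] miss little of
    [B0]; the own pair [xa] would lie in too many triangles. *)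
Lemma sides_disjoint : [disjoint side B0 & side A0].
Proof.
rewrite -setI_eq0; apply/eqP/setP => x; rewrite !inE; apply/negP => /andP[xA xB].
have [a aA xa] : exists2 a, a \in A0 & G x a by apply: own_nbr; rewrite // inE.
have := common_own B0 x a; have := own_few_triangles unif pages xa.
have : (#|[set z in B0 | G x z & G a z]| <= #|[set w | shadow H x w & shadow H a w]|)%N.
  apply/subset_leq_card/subsetP => z; rewrite !inE => /and3P[_ xz az].
  by rewrite !(own_shadow _).
move=> /leq_trans h /h; rewrite -(ler_nat rat) -natr1.
by have := missA aA; move: eta_n beta_n n_gt0 xA n_large T0 largeB; lra.
Qed.

(** Two vertices on the same side have most of [Y] as common own neighbours, more than
    [few_common_own] permits for a shadow pair. *)
Lemma side_shadowless (Y : {set V}) x y : n / 5 <= #|Y|%:R ->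
  x \in side Y -> y \in side Y -> ~~ sh x y.
Proof.
rewrite !inE => Yn xY yY; apply/negP => xy.
have := few_common_own pages xy; have := common_own Y x y.
have : (#|[set z in Y | G x z & G y z]| <= #|[set w | G x w & G y w]|)%N.
  by apply/subset_leq_card/subsetP => z; rewrite !inE => /andP[].
rewrite -(ler_nat rat) => h1 h2; rewrite -(ler_nat rat) => h3.
by move: h1 h2 h3 eta_n beta_n n_gt0 xY yY n_large T0 Yn; lra.
Qed.

Lemma one_per_side (Y : {set V}) h x y : n / 5 <= #|Y|%:R ->
  h \in H -> x \in h -> y \in h -> x \in side Y -> y \in side Y -> x = y.
Proof.
move=> Yn hH xh yh xY yY; apply/eqP; have := side_shadowless Yn xY yY.
by apply: contraNT => xy; apply: mem_shadow hH _ _ _.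
Qed.

Let s : rat := #|Z|%:R.

Let sizes : #|A|%:R + #|B|%:R + s = n :> rat.
Proof. by rewrite -!natrD /n -(cardsUI A B) (disjoint_setI0 sides_disjoint) cards0 addn0 cardsC. Qed.

Let in_ABZ x : [|| x \in A, x \in B | x \in Z].
Proof. by rewrite in_setC in_setU orbA orbN. Qed.

Lemma meets_Z h : h \in H -> exists2 z, z \in h & z \in Z.
Proof.
move=> hH; apply/exists_inP; apply: contraT => /exists_inPn noZ.
have : (#|h| <= #|A :&: h| + #|B :&: h|)%N.
  apply: leq_trans (leq_of_leqif (leq_card_setU _ _)).
  apply/subset_leq_card/subsetP => x xh; have := in_ABZ x; rewrite !in_setU !in_setI xh !andbT.
  by rewrite (negPf (noZ x xh)) orbF.
suff c1 (Y : {set V}) : n / 5 <= #|Y|%:R -> (#|side Y :&: h| <= 1)%N.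
  by rewrite (unif hH) => le3; have := leq_trans le3 (leq_add (c1 _ largeB) (c1 _ largeA)).
move=> Yn; apply/card_le1P => x; rewrite in_setI => /andP[xY xh] y.
rewrite in_setI [RHS]inE; apply/andP/eqP => [[yY yh]|->] //.
exact: one_per_side Yn hH yh xh yY xY.
Qed.

(** [z] misses more than [n / 100] vertices of each class. If it has an own neighbour in [A0], it
    has few in [B0], by [own_few_triangles]; so its degree is essentially confined to one class. *)
Lemma degree_Z (M : rat) z : #|A|%:R <= M -> #|B|%:R <= M -> z \in Z -> d z <= M - n / 200.
Proof.
move=> AM BM; rewrite !inE negb_or -!ltNge => /andP[zA zB].
have adjE (Y : {set V}) : #|Y|%:R = #|[set y in Y | G z y]|%:R + #|[set y in Y | ~~ G z y]|%:R :> rat.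
  rewrite -natrD -(cardsID [set y | G z y] Y); congr (_ + _)%:R; apply: eq_card => y.
    by rewrite !inE.
  by rewrite !inE andbC.
have dE : d z <= #|[set y in A0 | G z y]|%:R + #|[set y in B0 | G z y]|%:R + eta * n.
  apply: le_trans (lerD (lexx _) rest0); rewrite -!natrD ler_nat.
  apply: leq_trans (leq_add (leq_of_leqif (leq_card_setU _ _)) (leqnn _)).
  apply: leq_trans (leq_of_leqif (leq_card_setU _ _)).
  apply/subset_leq_card/subsetP => y; rewrite !inE => ->.
  by case: (y \in A0); case: (y \in B0).
have A0A : #|A0|%:R <= #|A|%:R :> rat by rewrite ler_nat subset_leq_card.
have B0B : #|B0|%:R <= #|B|%:R :> rat by rewrite ler_nat subset_leq_card.
have EA := adjE A0; have EB := adjE B0.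
have [/exists_inP[a aA za]|/exists_inPn no] := boolP [exists a in A0, G z a].
  have : #|[set y in B0 | G z y]|%:R <= T%:R + 1 + eta * n.
    apply: le_trans (lerD (lexx _) (missA aA)); rewrite natr1 -natrD ler_nat.
    apply: leq_trans (leq_add (own_few_triangles unif pages za) (leqnn _)).
    apply: leq_trans (leq_of_leqif (leq_card_setU _ _)).
    apply/subset_leq_card/subsetP => y; rewrite !inE => /andP[yB zy].
    by rewrite (own_shadow zy) yB /=; have [ay|_] := boolP (G a y); rewrite ?orbT // (own_shadow ay).
  by move: EA dE zB eta_n beta_n n_gt0 n_large T0 A0A AM; lra.
have : [set y in A0 | G z y] = set0.
  by apply/setP => y; rewrite !inE; case yA: (y \in A0) => //=; apply/negbTE/no.
move=> e0; move: dE; rewrite e0 cards0.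
by move: EB zA eta_n beta_n n_gt0 n_large T0 B0B BM; lra.
Qed.

Lemma edge_shape e z : e \in H -> z \in e -> z \in Z ->
  (forall u, u \in e -> u != z -> u \notin U) ->
  exists a b, [/\ a \in A0, b \in B0 & e = [set a; b; z]].
Proof.
move=> eH ze zZ noU.
have /card_gt1P[x [y [xe ye xy]]] : (1 < #|e :\ z|)%N.
  by have := unif eH; rewrite (cardsD1 z) ze add1n => -[->].
move: xe ye; rewrite !in_setD1 => /andP[xz xe] /andP[yz ye].
have eE : e = [set x; y; z] by apply: (edge_eq unif eH xe ye ze xy); rewrite eq_sym.
have := noU x xe xz; have := noU y ye yz; rewrite !in_setC !negbK !in_setU.
case yA: (y \in A0) => /=; case xA: (x \in A0) => /=.
- move=> _ _; case/eqP: xy.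
  by apply: (one_per_side largeB eH xe ye); exact: (subsetP subA).
- by move=> _ xB; exists y, x; split=> //; rewrite eE [[set x; y]]setUC.
- by move=> yB _; exists x, y.
- move=> yB xB; case/eqP: xy.
  by apply: (one_per_side largeA eH xe ye); exact: (subsetP subB).
Qed.

Let crossing := [set p : V * V | [&& p.1 \in A, p.2 \in B & G p.1 p.2]].
Let crossingE x y : ((x, y) \in crossing) = [&& x \in A, y \in B & G x y].
Proof. exact: in_set. Qed.
Let multi := [set p : V * V | [&& p.1 \in A0, p.2 \in B0 & thick H p.1 p.2]].

Let multiE x y : ((x, y) \in multi) = [&& x \in A0, y \in B0 & thick H x y].
Proof. exact: in_set. Qed.

(** No own pair lies inside a side, so each is crossing or meets [Z]; the factors 2 account for
    orientations. *)
Lemma card_own : (#|[set p | G p.1 p.2]| <= 2 * #|crossing| + 2 * \sum_(z in Z) #|[set y | G z y]|)%N.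
Proof.
pose swap (p : V * V) := (p.2, p.1).
have swap_inj : injective swap by move=> [? ?] [? ?] [-> ->].
pose atZ := [set p : V * V | (p.1 \in Z) && G p.1 p.2].
have atZE : #|atZ| = (\sum_(z in Z) #|[set y | G z y]|)%N.
  rewrite (card_rel (fun x y => (x \in Z) && G x y)) [RHS]big_mkcond /=.
  by apply: eq_bigr => x _; case: (x \in Z) => //=; rewrite (eq_card0 (A := [set y | false])) // => y; rewrite inE.
have atZP x y : ((x, y) \in atZ) = (x \in Z) && G x y by exact: in_set.
have sub : [set p | G p.1 p.2] \subset (crossing :|: swap @: crossing) :|: (atZ :|: swap @: atZ).
  apply/subsetP => -[x y]; rewrite inE /= => xy; rewrite !in_setU.
  have swapP (S : {set V * V}) : ((x, y) \in swap @: S) = ((y, x) \in S).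
    apply/imsetP/idP => [[[a b] ab [-> ->]] //|yx]; by exists (y, x).
  have yx : G y x by rewrite own_sym.
  rewrite !swapP !crossingE !atZP xy yx !andbT.
  have := in_ABZ x; have := in_ABZ y.
  case yZ: (y \in Z); rewrite ?orbT //; case xZ: (x \in Z); rewrite ?orbT //= !orbF.
  case xA: (x \in A); case yA: (y \in A); rewrite ?orbT //=.
  - by have := side_shadowless largeB xA yA; rewrite (own_shadow xy).
  - by move=> ->.
  - move=> yB xB; have := side_shadowless largeA xB yB.
    by rewrite (own_shadow xy).
have U2 (X Y : {set V * V}) := leq_of_leqif (leq_card_setU X Y).
apply: leq_trans (subset_leq_card sub) _; apply: leq_trans (U2 _ _) _.
by apply: leq_add; apply: leq_trans (U2 _ _) _; rewrite card_imset // ?atZE addnn -mul2n.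
Qed.

Lemma card_edges : #|H|%:R <= #|crossing|%:R + \sum_(z in Z) d z + #|F|%:R :> rat.
Proof.
rewrite -natr_sum -!natrD ler_nat addnC -leq_subLR.
rewrite -(leq_pmul2r (isT : 0 < 2)%N) (leq_trans (card_nonfull_edges unif)) //.
by rewrite mulnC mulnDr card_own.
Qed.

(* Pays for the term [#|multi|] of [card_regular]. *)
Lemma crossing_multi : #|crossing|%:R + #|multi|%:R <= #|A|%:R * #|B|%:R :> rat.
Proof.
rewrite -natrD -natrM ler_nat -cardsX -cardsUI.
have -> : crossing :&: multi = set0.
  apply/setP => -[x y]; rewrite in_setI crossingE multiE in_set0.
  apply/negP => /andP[/and3P[_ _ xy] /and3P[_ _ /andP[_]]].
  by rewrite ltnNge (own_codeg xy).
rewrite cards0 addn0; apply/subset_leq_card/subsetP => -[x y].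
rewrite in_setU crossingE multiE in_setX /=.
by case/orP => /and3P[xA yB _]; rewrite ?xA ?yB // (subsetP subA) ?(subsetP subB).
Qed.

(** * Colours of own pairs, centres and full hyperedges *)

Definition nbrs (Y : {set V}) z := [set y in Y | sh z y].

Lemma in_nbrs Y z y : (y \in nbrs Y z) = (y \in Y) && sh z y.
Proof. exact: in_set. Qed.

(** The vertices lost are at most [eta * n] that form no own pair with [a], and at most [T] whose
    own pair with [a] has a colour other than [z]. *)
Lemma coloured (Y : {set V}) a z : sh a z -> #|[set b in Y | ~~ G a b]|%:R <= eta * n ->
  #|nbrs Y z|%:R <= #|[set b in nbrs Y z | G a b && covers H a b z]|%:R + (eta * n + T%:R).
Proof.
move=> az aY; apply: le_trans (lerD (lexx _) (lerD aY (lexx _))).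
rewrite -!natrD ler_nat.
apply: leq_trans (leq_add (leqnn _) (leq_add (leqnn _) (few_miscoloured pages az))).
apply: leq_trans (leq_add (leqnn _) (leq_of_leqif (leq_card_setU _ _))).
apply: leq_trans (leq_of_leqif (leq_card_setU _ _)).
apply/subset_leq_card/subsetP => b; rewrite in_nbrs !in_setU !in_set => /andP[-> ->] /=.
by case: (G a b); case: (covers H a b z).
Qed.

Lemma own_covers_uniq a b z z' : G a b -> covers H a b z -> covers H a b z' ->
  sh z a -> sh z b -> sh z' a -> sh z' b -> z = z'.
Proof.
move=> ab /exists_inP[e eH /and3P[ae be ze]] /exists_inP[e' e'H /and3P[ae' be' ze']].
move=> /shadowP[za _] /shadowP[zb _] /shadowP[z'a _] /shadowP[z'b _].
have [e0 [_ _ neq uni _]] := ownP ab.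
have := edge_eq unif eH ae be ze neq za zb; rewrite (uni e) // => e0E.
move: ze'; rewrite (uni e') // e0E !inE (negPf z'a) (negPf z'b) => /eqP ->.
by [].
Qed.

Definition full_via (S : {set V * V}) :=
  [set e in F | [exists p in S, [&& p.1 != p.2, p.1 \in e & p.2 \in e]]].

Lemma in_full_via (S : {set V * V}) e x y : e \in F -> (x, y) \in S -> x != y -> x \in e -> y \in e ->
  e \in full_via S.
Proof.
by move=> eF xyS xy xe ye; rewrite in_set eF; apply/exists_inP; exists (x, y); rewrite //= xy xe ye.
Qed.

Lemma card_full_via (S : {set V * V}) : #|full_via S|%:R <= T%:R * #|S|%:R :> rat.
Proof.
apply: (@card_rel_bound _ _ (full_via S) S (fun e p => [&& p.1 != p.2, p.1 \in e & p.2 \in e]) T%:R).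
  by move=> e; rewrite in_set => /andP[_ /exists_inP].
move=> p _; have [->|neq] := eqVneq p.1 p.2.
  by rewrite (_ : [set e in _ | _] = set0) ?cards0 //; apply/setP => e; rewrite in_set0 in_set andbF.
rewrite ler_nat; apply: leq_trans (few_full_edges unif pages neq).
by apply/subset_leq_card/subsetP => e; rewrite !in_set => /andP[/andP[-> _] ->].
Qed.

Lemma card_fst_fiber (X : {set V * V}) (Y : {set V}) z :
  (forall a, (a, z) \in X -> a \in Y) -> (#|[set p in X | p.2 == z]| <= #|Y|)%N.
Proof.
move=> XY; rewrite -(card_imset Y (_ : injective (fun a => (a, z)))); last by move=> ? ? [].
apply/subset_leq_card/subsetP => -[a z']; rewrite in_set => /andP[azX /eqP /= zz].
by apply/imsetP; exists a; rewrite -?zz // XY // -zz.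
Qed.

Definition thin (Y : {set V}) :=
  [set p : V * V | [&& p.1 \in nbrs Y p.2, p.2 \in Z & #|nbrs Y p.2|%:R < beta * n]].

Lemma in_thin Y a z :
  ((a, z) \in thin Y) = [&& a \in nbrs Y z, z \in Z & #|nbrs Y z|%:R < beta * n].
Proof. exact: in_set. Qed.

Lemma card_thin Y : #|thin Y|%:R <= beta * n * s.
Proof.
apply: (@card_rel_bound _ _ (thin Y) Z (fun p z => p.2 == z)) => [[a z]|z zZ].
  by rewrite in_thin => /and3P[_ zZ _]; exists z.
have [small|big] := ltP #|nbrs Y z|%:R (beta * n).
  apply: le_trans (ltW small); rewrite ler_nat; apply: card_fst_fiber => a.
  by rewrite in_thin => /andP[].
rewrite (_ : [set p in _ | _] = set0) ?cards0 ?mulr_ge0 ?ltW //.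
apply/setP => -[a z']; rewrite in_set0 in_set /=; apply/negP => /andP[+ /eqP zz].
by rewrite zz in_thin ltNge big !andbF.
Qed.

Definition centers := [set z | (beta * n <= #|nbrs A0 z|%:R) && (beta * n <= #|nbrs B0 z|%:R)].

Lemma in_centers z :
  (z \in centers) = (beta * n <= #|nbrs A0 z|%:R) && (beta * n <= #|nbrs B0 z|%:R).
Proof. exact: in_set. Qed.

Let bn0 : 0 < beta * n. Proof. by rewrite mulr_gt0. Qed.

Lemma center_Z z : z \in centers -> z \in Z.
Proof.
rewrite in_centers => /andP[zA zB]; have ne (Y : {set V}) : beta * n <= #|nbrs Y z|%:R ->
    exists2 y, y \in Y & sh z y.
  move/(lt_le_trans bn0); rewrite ltr0n => /card_gt0P[y]; rewrite in_nbrs => /andP[yY zy].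
  by exists y.
rewrite in_setC in_setU; apply/norP; split; apply/negP => zS.
  have [a aA za] := ne _ zA; have := side_shadowless largeB zS (subsetP subA a aA).
  by rewrite za.
have [b bB zb] := ne _ zB; have := side_shadowless largeA zS (subsetP subB b bB).
by rewrite zb.
Qed.

Definition shared (z z' : V) := [exists b in nbrs B0 z, b \in nbrs B0 z'].
(** If two centres [z] and [z'] extended the same pair [ab] to full hyperedges, then [(a, z)] would
    lie here; away from these pairs, [ab] determines its centre. *)
Definition double := [set p : V * V | [&& p.1 \in nbrs A0 p.2, p.2 \in centers &
  [exists z' in centers, [&& z' != p.2, p.1 \in nbrs A0 z' & shared p.2 z']]]].

Lemma in_double a z : ((a, z) \in double) = [&& a \in nbrs A0 z, z \in centers &
  [exists z' in centers, [&& z' != z, a \in nbrs A0 z' & shared z z']]].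
Proof. exact: in_set. Qed.

(** Let [b] be a common neighbour in [B0]. A common neighbour [a] in [A0] cannot form with [b] an
    own pair of both colours [z] and [z'], so it is missed by [b] or miscoloured for one of them. *)
Lemma shared_nbrs z z' : z != z' -> shared z z' ->
  #|nbrs A0 z :&: nbrs A0 z'|%:R <= eta * n + 2 * T%:R.
Proof.
move=> zz /exists_inP[b]; rewrite !in_nbrs => /andP[bB zb] /andP[_ z'b].
apply: le_trans (lerD (missB bB) (lexx _)); rewrite -natrM -natrD ler_nat mul2n -addnn.
have bz : sh b z by rewrite shadow_sym.
have bz' : sh b z' by rewrite shadow_sym.
apply: leq_trans (leq_add (leqnn _) (leq_add (few_miscoloured pages bz) (few_miscoloured pages bz'))).
apply: leq_trans (leq_add (leqnn _) (leq_of_leqif (leq_card_setU _ _))).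
apply: leq_trans (leq_of_leqif (leq_card_setU _ _)).
apply/subset_leq_card/subsetP => a; rewrite in_setI !in_nbrs !in_setU !in_set.
move=> /andP[/andP[-> za] /andP[_ z'a]]; rewrite za z'a /=.
have [ba|//] := boolP (G b a); rewrite /= -negb_and; apply/negP => /andP[c c'].
by case/eqP: zz; apply: (own_covers_uniq ba c c').
Qed.

Lemma card_double : #|double|%:R <= (eta * n + 2 * T%:R) * #|centers|%:R ^+ 2.
Proof.
have -> : #|centers|%:R ^+ 2 = #|setX centers centers|%:R :> rat by rewrite cardsX natrM expr2.
apply: (@card_rel_bound _ _ double (setX centers centers) (fun p q =>
  [&& p.2 == q.1, q.2 != q.1, p.1 \in nbrs A0 q.2 & shared q.1 q.2])).
  move=> [a z]; rewrite in_double => /and3P[az zC /exists_inP[z' z'C /and3P[zz az' sz]]].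
  by exists (z, z'); rewrite ?in_setX /= ?zC ?z'C ?eqxx ?zz ?az' ?sz.
move=> [z z'] _ /=; have [zz|] := boolP ((z' != z) && shared z z'); last first.
  move=> no; rewrite (_ : [set p in _ | _] = set0) ?cards0 ?addr_ge0 ?(ltW en0) ?mulr_ge0 //.
  apply/setP => p; rewrite in_set0 in_set; apply/negP => /andP[_ /and4P[_ h1 _ h2]].
  by rewrite h1 h2 in no.
case/andP: zz => zz sz; apply: le_trans (shared_nbrs _ sz); last by rewrite eq_sym.
rewrite ler_nat; pose X := [set p in double | p.1 \in nbrs A0 z'].
apply: leq_trans (_ : #|[set p in X | p.2 == z]| <= _)%N.
  apply/subset_leq_card/subsetP => p; rewrite !in_set.
  by move=> /andP[-> /and4P[-> _ -> _]].
apply: card_fst_fiber => a; rewrite in_set in_double in_setI /=.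
by move=> /andP[/and3P[-> _ _] ->].
Qed.

(** Each centre is the colour of at least [(beta * n) ^+ 2 / 2] own pairs between [A0] and [B0], and
    an own pair has only one colour. *)
Lemma card_centers : #|centers|%:R * beta ^+ 2 <= 2 :> rat.
Proof.
pose good z (p : V * V) :=
  [&& p.1 \in nbrs A0 z, p.2 \in nbrs B0 z, G p.1 p.2 & covers H p.1 p.2 z].
pose Q := [set q : V * (V * V) | (q.1 \in centers) && good q.1 q.2].
have upper : #|Q|%:R <= n ^+ 2.
  have -> : n ^+ 2 = 1 * #|[set: V * V]|%:R by rewrite cardsT card_prod natrM mul1r expr2.
  apply: (@card_rel_bound _ _ Q setT (fun q p => q.2 == p)) => [q _|[a b] _]; first by exists q.2.
  rewrite lern1; apply/card_le1P => -[z p]; rewrite !in_set /= => /andP[/andP[zC gp] /eqP pE].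
  move=> [z' p']; rewrite !in_set [RHS]inE /= xpair_eqE; move: (gp); rewrite pE.
  move=> /and4P[/=]; rewrite !in_nbrs => /andP[_ za] /andP[_ zb] ab c.
  apply/andP/andP => [[/andP[_ gp'] /eqP pE']|[/eqP -> /eqP ->]]; last first.
    by rewrite zC -pE gp eqxx.
  move: gp'; rewrite pE' => /and4P[/=]; rewrite !in_nbrs => /andP[_ za'] /andP[_ zb'] _ c'.
  by rewrite eqxx (own_covers_uniq ab c' c za' zb' za zb) eqxx.
have lower : #|centers|%:R * (beta * n * (beta * n / 2)) <= #|Q|%:R.
  have -> : #|centers|%:R * (beta * n * (beta * n / 2)) =
      \sum_(z in centers) (beta * n * (beta * n / 2)).
    by rewrite sum_const_set cardsE.
  rewrite (card_rel (fun z p => (z \in centers) && good z p)) natr_sum big_mkcond /=.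
  apply: ler_sum => z _; have [zC|//] := boolP (z \in centers).
  rewrite /= (card_rel (fun a b => good z (a, b))) natr_sum.
  move: zC; rewrite in_centers => /andP[zA zB].
  apply: (@le_trans _ _ (\sum_(a in nbrs A0 z) (beta * n / 2))).
    by rewrite sum_const_set cardsE ler_wpM2r // divr_ge0 // ltW.
  rewrite big_mkcond; apply: ler_sum => a _; case: ifP => [aN|_] //.
  have aN' := aN; move: aN'; rewrite in_nbrs => /andP[aA za].
  have az : sh a z by rewrite shadow_sym.
  have := coloured az (missA aA).
  have : (#|[set b in nbrs B0 z | G a b && covers H a b z]| <= #|[set y | good z (a, y)]|)%N.
    apply/subset_leq_card/subsetP => b; rewrite !in_set /good /= aN.
    by rewrite in_nbrs => /andP[/andP[-> ->] ->].
  by rewrite -(ler_nat rat); move: zB n_large T0 eta_n n_gt0 bn0; lra.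
have nn : 0 < n ^+ 2 by rewrite exprn_gt0.
rewrite -(ler_pM2r nn).
have := le_trans lower upper; lra.
Qed.

(** By [coloured], many hyperedges contain both [z] and [y], whereas an own pair lies in one
    only. *)
Lemma center_not_own (Y : {set V}) z y : beta * n <= #|nbrs Y z|%:R ->
  #|[set b in Y | ~~ G y b]|%:R <= eta * n -> ~~ G z y.
Proof.
move=> zY yY; apply/negP => zy; have yz : sh y z by rewrite shadow_sym (own_shadow zy).
have := coloured yz yY; have [e [eH _ _ uni _]] := ownP zy.
have : (#|[set b in nbrs Y z | G y b && covers H y b z]| <= 3)%N.
  rewrite -(unif eH); apply/subset_leq_card/subsetP => b.
  rewrite !in_set => /and3P[_ _ /exists_inP[h hH /and3P[yh bh zh]]].
  by rewrite -(uni h).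
by rewrite -(ler_nat rat); move: zY n_large T0 eta_n; lra.
Qed.

Lemma degree_center z : z \in centers -> d z <= eta * n.
Proof.
rewrite in_centers => /andP[zA zB]; apply: le_trans rest0; rewrite ler_nat.
apply/subset_leq_card/subsetP => y; rewrite in_set in_setC in_setU => zy.
apply/norP; split; apply: contraTN zy => yY.
  exact: center_not_own zB (missA yY).
exact: center_not_own zA (missB yY).
Qed.

(** Each set of pairs excludes one defect: a further vertex outside [A0] and [B0], a vertex of [Z]
    with few neighbours in [A0] or in [B0], and a pair extended by two centres. *)
Let exceptional := full_via (setX U Z) :|: full_via (thin A0) :|: full_via (thin B0)
  :|: full_via double.

Lemma regular_shape e : e \in F -> e \notin exceptional ->
  exists a b z, [/\ a \in nbrs A0 z, b \in nbrs B0 z, e = [set a; b; z], z \in centers &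
    e \notin full_via double].
Proof.
move=> eF; rewrite !in_setU !negb_or => /andP[/andP[/andP[nUZ nA] nB] nD].
have eH : e \in H by move: eF; rewrite in_set => /andP[].
have [z ze zZ] := meets_Z eH.
have noU u : u \in e -> u != z -> u \notin U.
  move=> ue uz; apply: contra nUZ => uU; apply: in_full_via eF _ uz ue ze.
  by rewrite in_setX uU.
have [a [b [aA bB eE]]] := edge_shape eH ze zZ noU.
have ae : a \in e by rewrite eE !in_setU set11.
have be : b \in e by rewrite eE !in_setU set11 orbT.
have neZ (Y : {set V}) x : Y \subset A \/ Y \subset B -> x \in Y -> x != z.
  by move=> YS xY; apply: contraTneq zZ => <-; rewrite in_setC in_setU negbK;
     case: YS => /subsetP/(_ x xY) ->; rewrite ?orbT.
have az : a != z by apply: neZ aA; left.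
have bz : b != z by apply: neZ bB; right.
have aN : a \in nbrs A0 z by rewrite in_nbrs aA (mem_shadow eH ze ae) // eq_sym.
have bN : b \in nbrs B0 z by rewrite in_nbrs bB (mem_shadow eH ze be) // eq_sym.
exists a, b, z; split=> //; rewrite in_centers !leNgt; apply/andP; split.
  by apply: contra nA => small; apply: in_full_via eF _ az ae ze; rewrite in_thin aN zZ.
by apply: contra nB => small; apply: in_full_via eF _ bz be ze; rewrite in_thin bN zZ.
Qed.

(** A regular full hyperedge contains a thick pair between [A0] and [B0], and the exclusion of
    [double] makes this assignment injective. *)
Lemma card_regular : #|F :\: exceptional|%:R <= #|multi|%:R :> rat.
Proof.
rewrite -[leRHS]mul1r.
apply: (@card_rel_bound _ _ (F :\: exceptional) multi (fun e p => (p.1 \in e) && (p.2 \in e))).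
  move=> e; rewrite in_setD => /andP[nX eF].
  have [a [b [z [aN bN eE _ _]]]] := regular_shape eF nX.
  have ae : a \in e by rewrite eE !in_setU set11.
  have be : b \in e by rewrite eE !in_setU set11 orbT.
  move: aN bN; rewrite !in_nbrs => /andP[aA _] /andP[bB _].
  exists (a, b); rewrite /= ?ae ?be // multiE aA bB.
  move: eF; rewrite in_set => /andP[_ fe]; apply: (full_thick fe ae be).
  by apply: contraTneq aA => ->; rewrite (disjointFl disj0 bB).
move=> [a b]; rewrite multiE => /and3P[aA bB _].
have shape e : e \in F :\: exceptional -> a \in e -> b \in e ->
    exists z, [/\ a \in nbrs A0 z, b \in nbrs B0 z, e = [set a; b; z], z \in centers &
    e \notin full_via double].
  rewrite in_setD => /andP[nX eF]; have [a' [b' [z [aN bN eE zC nD]]]] := regular_shape eF nX.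
  move=> ae be; have eH : e \in H by move: eF; rewrite in_set => /andP[].
  have ae' : a' \in e by rewrite eE !in_setU set11.
  have be' : b' \in e by rewrite eE !in_setU set11 orbT.
  have [aA' bB'] : a' \in A0 /\ b' \in B0.
    by move: aN bN; rewrite !in_nbrs => /andP[-> _] /andP[-> _].
  have aa : a = a' by apply: (one_per_side largeB eH ae ae'); exact: (subsetP subA).
  have bb : b = b' by apply: (one_per_side largeA eH be be'); exact: (subsetP subB).
  by exists z; rewrite aa bb.
rewrite lern1; apply/card_le1P => e; rewrite in_set => /and3P[eX ae be] e'.
rewrite in_set [RHS]inE; apply/and3P/eqP => [[eX' ae' be']|-> //].
have [z [az bz eE zC nD]] := shape e eX ae be; have [z' [az' bz' eE' zC' _]] := shape e' eX' ae' be'.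
have [zz|zz] := eqVneq z' z; first by rewrite eE eE' zz.
case/negP: nD; apply: (@in_full_via _ _ a z).
- by move: eX; rewrite in_setD => /andP[].
- rewrite in_double az zC; apply/exists_inP; exists z' => //; rewrite zz az' /=.
  by apply/exists_inP; exists b.
- by move: az; rewrite in_nbrs => /andP[_ /shadowP[+ _]]; rewrite eq_sym.
- exact: ae.
- by rewrite eE !in_setU set11 orbT.
Qed.

Lemma card_full : #|F|%:R <= #|F :\: exceptional|%:R + T%:R * (eta * n * s + 2 * (beta * n * s)
   + (eta * n + 2 * T%:R) * #|centers|%:R ^+ 2).
Proof.
have split_card : #|F|%:R <= #|F :\: exceptional|%:R + (#|full_via (setX U Z)|%:R +
    #|full_via (thin A0)|%:R + #|full_via (thin B0)|%:R + #|full_via double|%:R) :> rat.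
  rewrite -!natrD ler_nat.
  have U2 (X Y : {set {set V}}) := leq_of_leqif (leq_card_setU X Y).
  rewrite -(cardsID exceptional F) addnC leq_add2l.
  apply: leq_trans (subset_leq_card (subsetIr _ _)) _.
  apply: leq_trans (U2 _ _) _; rewrite leq_add2r.
  apply: leq_trans (U2 _ _) _; rewrite leq_add2r.
  exact: U2.
apply: le_trans split_card _; rewrite lerD2l.
have h1 : #|full_via (setX U Z)|%:R <= T%:R * (eta * n * s).
  apply: le_trans (card_full_via _) _; rewrite ler_wpM2l // cardsX natrM.
  by rewrite ler_wpM2r.
have h2 : #|full_via (thin A0)|%:R <= T%:R * (beta * n * s).
  by apply: le_trans (card_full_via _) _; rewrite ler_wpM2l // card_thin.
have h3 : #|full_via (thin B0)|%:R <= T%:R * (beta * n * s).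
  by apply: le_trans (card_full_via _) _; rewrite ler_wpM2l // card_thin.
have h4 : #|full_via double|%:R <= T%:R * ((eta * n + 2 * T%:R) * #|centers|%:R ^+ 2).
  by apply: le_trans (card_full_via _) _; rewrite ler_wpM2l // card_double.
apply: le_trans (lerD (lerD (lerD h1 h2) h3) h4) _; rewrite -!mulrDr ler_wpM2l //.
by lra.
Qed.

(** The hyperedge of an own pair between the classes has its third vertex in [Z]. A vertex that is
    no centre has fewer than [beta * n] neighbours in one class, hence covers at most
    [beta * n ^+ 2] pairs. *)
Lemma crossing_covered : centers = set0 -> n ^+ 2 / 30 <= beta * n ^+ 2 * s.
Proof.
move=> C0; pose X := [set p : V * V | [&& p.1 \in A0, p.2 \in B0 & G p.1 p.2]].
have XE a b : ((a, b) \in X) = [&& a \in A0, b \in B0 & G a b] by exact: in_set.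
have low : n ^+ 2 / 30 <= #|X|%:R.
  rewrite (card_rel (fun a b => [&& a \in A0, b \in B0 & G a b])) natr_sum.
  apply: (@le_trans _ _ (\sum_(a in A0) (n / 6))).
    rewrite sum_const_set cardsE; apply: (@le_trans _ _ (n / 5 * (n / 6))).
      by rewrite expr2; lra.
    by rewrite ler_wpM2r // divr_ge0 // ltW.
  rewrite big_mkcond; apply: ler_sum => a _; case: ifP => [aA|_] //=.
  have := missA aA; have : #|B0|%:R <= #|[set b in B0 | G a b]|%:R + #|[set b in B0 | ~~ G a b]|%:R :> rat.
    rewrite -natrD ler_nat; apply: leq_trans (leq_of_leqif (leq_card_setU _ _)).
    apply/subset_leq_card/subsetP => b bB; rewrite in_setU !in_set bB /=.
    by case: (G a b).
  by move: largeB eta_n beta_n n_gt0; lra.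
apply: le_trans low _.
pose R (p : V * V) z := (p.1 \in nbrs A0 z) && (p.2 \in nbrs B0 z).
apply: (@card_rel_bound _ _ X Z R) => [[a b]|z zZ].
  rewrite XE => /and3P[aA bB ab]; have [e [eH /andP[ae be] neq _ _]] := ownP ab.
  have [z [eE za zb]] := edge_third unif eH ae be neq.
  have ze : z \in e by rewrite eE !in_setU set11 !orbT.
  exists z; last by rewrite /R /= !in_nbrs aA bB (mem_shadow eH ze ae za) (mem_shadow eH ze be zb).
  rewrite in_setC in_setU; apply/norP; split; apply/negP => zS.
    case/eqP: za; apply: (one_per_side largeB eH ze ae zS); exact: (subsetP subA).
  case/eqP: zb; apply: (one_per_side largeA eH ze be zS); exact: (subsetP subB).
have : z \notin centers by rewrite C0 in_set0.
rewrite in_centers negb_and -!ltNge => thinz.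
apply: (@le_trans _ _ (#|nbrs A0 z|%:R * #|nbrs B0 z|%:R)).
  rewrite -natrM -cardsX ler_nat; apply/subset_leq_card/subsetP => -[a b].
  by rewrite in_set in_setX => /andP[_].
have le_n (Y : {set V}) : #|nbrs Y z|%:R <= n by rewrite ler_nat max_card.
rewrite expr2 mulrA; case/orP: thinz => /ltW thinz.
  by rewrite ler_pM.
by rewrite mulrC ler_pM.
Qed.

(** * Comparison with the extremal number *)

Let M : rat := Num.max #|A|%:R #|B|%:R.
Let AM : #|A|%:R <= M. Proof. by rewrite le_max lexx. Qed.
Let BM : #|B|%:R <= M. Proof. by rewrite le_max lexx orbT. Qed.

(** The left side is the product of the larger class with the smaller one enlarged by [k], so the
    inequality of the means applies. *)
Let balance (k : rat) : #|A|%:R * #|B|%:R + k * M <= (#|A|%:R + #|B|%:R + k) ^+ 2 / 4.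
Proof.
rewrite /M; case: (leP (#|A|%:R : rat) #|B|%:R) => _.
  have := sqr_ge0 (#|A|%:R + k - #|B|%:R : rat); rewrite !expr2; lra.
have := sqr_ge0 (#|B|%:R + k - #|A|%:R : rat); rewrite !expr2; lra.
Qed.

Let Tbeta : T%:R * (beta * n * s) * 1000 * 100 <= n * s.
Proof.
have ns0 : 0 <= n * s by apply: mulr_ge0 (ltW n_gt0) (ler0n _ _).
have := ler_wpM2l ns0 betaT; have := mulr_ge0 (ltW beta0) ns0.
by lra.
Qed.

Let Teta : T%:R * (eta * n * s) * 1000 * 1000 <= n * s.
Proof.
have ns0 : 0 <= n * s by apply: mulr_ge0 (ltW n_gt0) (ler0n _ _).
have b1 : beta ^+ 4 <= 1 by rewrite expr_le1 // ?(ltW beta0) //; move: beta_small beta0; lra.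
have := ler_wpM2l ns0 (le_trans etaT b1); have := mulr_ge0 (ltW eta0) ns0.
by lra.
Qed.

Let Tdouble : T%:R * ((eta * n + 2 * T%:R) * #|centers|%:R ^+ 2) * 1000 * 1000 <= 8 * n.
Proof.
have c4 : beta ^+ 4 * #|centers|%:R ^+ 2 <= 4.
  have -> : beta ^+ 4 * #|centers|%:R ^+ 2 = (#|centers|%:R * beta ^+ 2) ^+ 2 by ring.
  have -> : 4 = 2 ^+ 2 :> rat by [].
  have c0 : 0 <= #|centers|%:R * beta ^+ 2 by rewrite mulr_ge0 // sqr_ge0.
  by rewrite ler_pXn2r ?nnegrE //; exact: card_centers.
set c : rat := #|centers|%:R ^+ 2 in c4 *; have c0 : 0 <= c by apply: sqr_ge0.
have nc0 := mulr_ge0 (ltW n_gt0) c0.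
have t1 := ler_wpM2l nc0 etaT.
have t2 : T%:R * c * (2 * T%:R) <= T%:R * c * (eta * n).
  by rewrite ler_wpM2l ?mulr_ge0 //; move: n_large T0; lra.
have t3 := ler_wpM2l (ltW n_gt0) c4.
have t4 := mulr_ge0 (ltW eta0) nc0.
by lra.
Qed.

Lemma few_outside : (n - 1) ^+ 2 / 4 - 1 <= #|H|%:R -> (#|Z| <= 1)%N.
Proof.
move=> Hlow; rewrite leqNgt -(ler_nat rat); apply/negP => s2.
have {}s2 : 2 <= s by [].
have ns2 := ler_wpM2l (ltW n_gt0) s2.
have sumd (S : {set V}) : S \subset Z -> \sum_(z in S) d z <= #|S|%:R * (M - n / 200).
  move=> SZ; have -> : #|S|%:R * (M - n / 200) = \sum_(z in S) (M - n / 200).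
    by rewrite sum_const_set cardsE.
  by apply: ler_sum => z zS; apply: degree_Z AM BM _; apply: (subsetP SZ).
have n_big : 1000 <= n by move: eta_n beta_n n_large T0; lra.
(* If there is a centre [z0], its own degree is negligible, so [balance] is applied with the other
   [s - 1] vertices and compares directly with [(n - 1) ^+ 2 / 4]. Each of these loses [n / 200],
   more than the exceptional full hyperedges return. *)
have [C0|[z0 z0C]] := set_0Vmem centers; last first.
  have z0Z := center_Z z0C.
  have sumZ : \sum_(z in Z) d z <= eta * n + (s - 1) * (M - n / 200).
    rewrite (big_setD1 z0 z0Z); apply: lerD (degree_center z0C) _.
    have -> : s - 1 = #|Z :\ z0|%:R by rewrite /s [in LHS](cardsD1 z0) z0Z natrD addrAC subrr add0r.
    by apply: sumd; apply: subD1set.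
  have bal := balance (s - 1); have nE : #|A|%:R + #|B|%:R + (s - 1) = n - 1 by rewrite addrA sizes.
  rewrite nE in bal.
  have := card_edges; have := crossing_multi; have := card_full; have := card_regular.
  move: bal sumZ Tbeta Teta Tdouble ns2 n_big eta_n beta_n n_gt0 Hlow.
  move=> *; lra.
(* Without centres every full hyperedge is exceptional. Now the comparison is with [n ^+ 2 / 4],
   which exceeds the target by about [n / 2]; this still bounds [s] by 200, and so small a [Z]
   cannot cover the own pairs between the classes. *)
have bal := balance s; rewrite sizes in bal.
have F0 : F :\: exceptional = set0.
  apply/eqP; rewrite -subset0; apply/subsetP => e; rewrite in_setD => /andP[nX eF].
  by have [a [b [z [_ _ _ + _]]]] := regular_shape eF nX; rewrite C0 in_set0.
have := card_full; rewrite F0 C0 !cards0 expr0n !mulr0 => cF.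
have sumZ := sumd Z (subxx Z); rewrite -/s in sumZ.
have cX : #|crossing|%:R <= #|A|%:R * #|B|%:R :> rat.
  by have := crossing_multi; have : 0 <= #|multi|%:R :> rat by []; lra.
have s200 : n * s <= n * 200.
  by have := card_edges; move: bal sumZ Tbeta Teta cF cX ns2 n_big n_gt0 Hlow => *; lra.
have := crossing_covered C0.
have nn : 0 < n ^+ 2 by rewrite exprn_gt0.
rewrite (ler_pM2l n_gt0) in s200.
have := ler_wpM2r (ltW nn) beta_small.
have : beta * n ^+ 2 * s <= beta * n ^+ 2 * 200 by apply: ler_wpM2l s200; apply: mulr_ge0; exact: ltW.
by move: nn => *; lra.
Qed.

End Counting.

Local Close Scope ring_scope.

(** * Structure of hypergraphs close to the extremal size *)

Section Structure.
Local Open Scope ring_scope.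
Variable T : nat.

(** By [few_thick] the thick graph has few triangles on each edge, so [few_triangles] makes full
    hyperedges rare. The others yield about [n ^ 2 / 2] ordered own pairs, and [stability]
    applies. *)
Lemma own_bipartite (eta : rat) : 0 < eta -> eta <= 1 / 10 ->
  exists n0 : nat, forall (V : finType) (H : {set {set V}}),
  (forall h, h \in H -> #|h| = 3%N) ->
  (forall u v, shadow H u v ->
    (#|[set w | pair_avoiding H u w v && pair_avoiding H v w u]| <= T)%N) ->
  (n0 <= #|V|)%N -> (#|V|%:R - 1) ^+ 2 / 4 - 1 <= #|H|%:R :> rat ->
  4 * (T%:R + 1) <= eta * #|V|%:R /\
  exists A B : {set V}, [/\ [disjoint A & B], #|~: (A :|: B)|%:R <= eta * #|V|%:R,
    forall a, a \in A -> #|[set b in B | ~~ own H a b]|%:R <= eta * #|V|%:R,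
    forall b, b \in B -> #|[set a in A | ~~ own H b a]|%:R <= eta * #|V|%:R &
    #|V|%:R / 5 <= #|A|%:R :> rat /\ #|V|%:R / 5 <= #|B|%:R :> rat].
Proof.
move=> eta0 eta1.
have T0 : 0 < (T%:R + 1 : rat) by rewrite ltr_wpDl.
pose dl := eta ^+ 2 / 100.
have dl0 : 0 < dl by rewrite divr_gt0 // exprn_gt0.
have dle : dl <= eta by rewrite /dl expr2; nra.
have e0 : 0 < dl / 4 by rewrite divr_gt0.
have [n1 n1P] := few_triangles T e0.
pose b : rat := 4 * (T%:R + 1) / dl.
have b0 : 0 <= b by apply: divr_ge0 (ltW dl0); apply: mulr_ge0 (ltW T0).
exists (n1 + Num.bound b)%N => V H unif pages nV Hlow.
pose n : rat := #|V|%:R.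
have bn : b <= n.
  apply/ltW/(lt_le_trans (archi_boundP b0)).
  by rewrite ler_nat (leq_trans _ nV) // leq_addl.
have dn : 4 * (T%:R + 1) <= dl * n by move: bn; rewrite /b ler_pdivrMr // [n * _]mulrC.
have n0 : 0 < n.
  by rewrite -(pmulr_rgt0 _ dl0); apply: lt_le_trans dn; rewrite mulr_gt0.
have large : 4 * (T%:R + 1) <= eta * n by apply: le_trans dn _; rewrite ler_pM2r.
split=> //.
have cF : #|full_edges H|%:R <= dl / 4 * n ^+ 2.
  apply: (@le_trans _ _ #|triangles (thick H)|%:R).
    by rewrite ler_nat; exact: card_full_edges.
  apply: n1P; [exact: thick_sym | | exact: leq_trans (leq_addr _ _) nV].
  by move=> x y /thick_shadow; exact: few_thick.
have few x y : own H x y -> (#|[set z | own H x z && own H y z]| <= T.+1)%N.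
  move=> xy; apply: leq_trans (own_few_triangles unif pages xy).
  by apply/subset_leq_card/subsetP => z; rewrite !inE => /andP[/own_shadow-> /own_shadow->].
have PP : (1 / 2 - eta ^+ 2 / 100) * n ^+ 2 <= #|[set p | own H p.1 p.2]|%:R.
  have h1 : (#|H|%:R - #|full_edges H|%:R) * 2 <= #|[set p | own H p.1 p.2]|%:R :> rat.
    have := card_nonfull_edges unif; rewrite -(ler_nat rat) natrM; apply: le_trans.
    by rewrite ler_wpM2r // lerBlDr -natrD ler_nat addnC -leq_subLR.
  have dn2 : 4 * n <= dl * n ^+ 2.
    rewrite [n ^+ 2]expr2 mulrA ler_pM2r //; apply: le_trans dn.
    by rewrite -[leLHS]mulr1 ler_pM2l // lerDr.
  have n4 : 2 <= n.
    have : dl * n <= n by apply: ler_piMl; [exact: ltW | move: dle eta1; lra].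
    by move: dn (ler0n rat T); lra.
  by move: Hlow h1 cF; rewrite -/dl -/n !expr2 in dn2 *; lra.
apply: (@stability _ _ T.+1 (@own_sym _ H) few eta eta0 eta1 _ n0 PP).
by rewrite -natr1 -/dl; move: dn (ler0n rat T); lra.
Qed.

Lemma small_factor (c d : rat) : 0 < c -> 0 < d -> exists2 b : rat, 0 < b & b * c <= d.
Proof.
by move=> c0 d0; exists (d / c); rewrite ?divr_gt0 // divfK // lt0r_neq0.
Qed.

(** The constants are chosen in the order [beta], [eta], [n0]. The [- 1] in the lower bound on
    [#|H|] leaves room for the rounding in the extremal number. *)
Lemma structure : exists n0 : nat, forall (V : finType) (H : {set {set V}}),
  (forall h, h \in H -> #|h| = 3%N) ->
  (forall u v, shadow H u v ->
    (#|[set w | pair_avoiding H u w v && pair_avoiding H v w u]| <= T)%N) ->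
  (n0 <= #|V|)%N -> (#|V|%:R - 1) ^+ 2 / 4 - 1 <= #|H|%:R :> rat ->
  exists A B : {set V}, [/\ [disjoint A & B], (#|~: (A :|: B)| <= 1)%N,
    (forall h x y, h \in H -> x \in h -> y \in h -> x \in A -> y \in A -> x = y) &
    (forall h x y, h \in H -> x \in h -> y \in h -> x \in B -> y \in B -> x = y)].
Proof.
have T0 : 0 < (T%:R + 1 : rat) by rewrite ltr_wpDl.
have [beta beta0 betaT] : exists2 beta : rat, 0 < beta & beta * (1000 * 100 * (T%:R + 1)) <= 1.
  by apply: small_factor ltr01; apply: mulr_gt0 (T0); apply: mulr_gt0; rewrite ltr0n.
have [eta eta0 etaT] : exists2 eta : rat, 0 < eta & eta * (1000 * 1000 * (T%:R + 1)) <= beta ^+ 4.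
  apply: small_factor (exprn_gt0 _ beta0).
  by apply: mulr_gt0 (T0); apply: mulr_gt0; rewrite ltr0n.
have eta1 : eta <= 1 / 10.
  have beta1 : beta <= 1.
    by have := mulr_ge0 (ltW beta0) (ler0n _ T); move: betaT beta0; lra.
  have : beta ^+ 4 <= 1 by apply: exprn_ile1 (ltW beta0) beta1.
  by have := mulr_ge0 (ltW eta0) (ler0n _ T); move: etaT eta0; lra.
have [n0 n0P] := own_bipartite eta0 eta1.
exists n0 => V H unif pages nV Hlow.
have [large [A0 [B0 [disj0 rest0 missA missB [largeA largeB]]]]] := n0P V H unif pages nV Hlow.
(* [side H B0] is the enlargement of [A0] and [side H A0] that of [B0]: a side is defined by the
   class it is joined to. *)
exists (side H B0), (side H A0); split.
- exact: (sides_disjoint unif pages eta0 beta0 betaT etaT large missA largeA largeB).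
- exact: (few_outside unif pages eta0 beta0 betaT etaT large disj0 rest0 missA missB largeA largeB).
- by move=> h x y; apply: (one_per_side pages eta0 beta0 betaT etaT large largeB).
- by move=> h x y; apply: (one_per_side pages eta0 beta0 betaT etaT large largeA).
Qed.
End Structure.

(** * The extremal hypergraph *)

Lemma card_partA n : #|partA n.+1| = n./2.
Proof.
pose f (i : 'I_n./2) : 'I_n.+1 := inord i.+1.
have fE i : f i = i.+1 :> nat by rewrite /f inordK //; have := ltn_ord i; lia.
have f_inj : injective f.
  by move=> i j /(congr1 val) /=; rewrite !fE => -[] /val_inj.
rewrite -[RHS]card_ord -(card_imset _ f_inj); congr #|pred_of_set _|; apply/setP => i; rewrite inE.
apply/andP/imsetP => [[i0 ik]|[j _ ->]]; last by rewrite /= fE; split=> //; exact: ltn_ord.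
have ik' : i.-1 < n./2 by rewrite /= in i0 ik; lia.
by exists (Ordinal ik') => //; apply/val_inj; rewrite /= fE /= prednK.
Qed.

Lemma partAB_disjoint n : [disjoint partA n & partB n].
Proof.
rewrite -setI_eq0; apply/eqP/setP => i; rewrite !inE; apply/negP => /andP[/andP[_ h1] h2].
by rewrite leqNgt h2 in h1.
Qed.

Lemma partAB_cover n : ~: (partA n.+1 :|: partB n.+1) = [set ord0].
Proof.
apply/setP => i; rewrite !inE negb_or negb_and -!leqNgt -val_eqE /=.
by case: (val i) => [|j] //=; rewrite -ltnNge; case: leqP.
Qed.

Lemma card_partB n : #|partB n.+1| = uphalf n.
Proof.
have := cardsC (partA n.+1 :|: partB n.+1); rewrite partAB_cover cards1 card_ord.
have := cardsUI (partA n.+1) (partB n.+1); rewrite (disjoint_setI0 (partAB_disjoint _)) cards0.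
by rewrite card_partA uphalf_half; have := odd_double_half n; lia.
Qed.

Lemma half_mul_uphalf n : n./2 * uphalf n = n ^ 2 %/ 4.
Proof.
rewrite uphalf_half; have := odd_double_half n; set k := n./2; case: (odd n) => /= <-.
  have -> : (1 + k.*2) ^ 2 = k * (1 + k) * 4 + 1 by rewrite -mul2n !expnS expn0; lia.
  by rewrite divnMDl // addn0.
have -> : (0 + k.*2) ^ 2 = k * (0 + k) * 4 by rewrite -mul2n !expnS expn0; lia.
by rewrite mulnK.
Qed.

Lemma extremalP n (e : {set 'I_n.+1}) :
  reflect (exists a b, [/\ a \in partA n.+1, b \in partB n.+1 & e = [set ord0; a; b]])
    (e \in extremal n.+1).
Proof.
rewrite inE; apply: (iffP existsP) => [[z /existsP[a /existsP[b /and4P[z0 aA bB /eqP ->]]]]|].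
  by exists a, b; split=> //; have -> : z = ord0 by apply/val_inj/eqP.
case=> a [b [aA bB ->]]; exists ord0; apply/existsP; exists a; apply/existsP; exists b.
by rewrite aA bB !eqxx.
Qed.

Lemma partA_neq0 n a : a \in partA n.+1 -> a != ord0.
Proof. by rewrite inE => /andP[+ _]; rewrite -val_eqE lt0n. Qed.

Lemma partB_neq0 n b : b \in partB n.+1 -> b != ord0.
Proof. by rewrite inE -val_eqE /= => /(leq_ltn_trans (leq0n _)); rewrite lt0n. Qed.

Lemma card_extremal n : #|extremal n.+1| = n ^ 2 %/ 4.
Proof.
rewrite -half_mul_uphalf -card_partA -card_partB -cardsX.
pose f (p : 'I_n.+1 * 'I_n.+1) := [set ord0; p.1; p.2].
have -> : extremal n.+1 = f @: setX (partA n.+1) (partB n.+1).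
  apply/setP => e; apply/extremalP/imsetP => [[a [b [aA bB ->]]]|[[a b]]].
    by exists (a, b); rewrite ?in_setX ?aA.
  by rewrite in_setX => /andP[aA bB] ->; exists a, b.
rewrite card_in_imset // => -[a b] [a' b']; rewrite !in_setX => /andP[/= aA bB] /andP[/= aA' bB'].
have AB x y : x \in partA n.+1 -> y \in partB n.+1 -> x != y.
  by move=> xA yB; apply: contraTneq xA => ->; rewrite (disjointFl (partAB_disjoint _) yB).
rewrite /f /= => E; congr pair.
  have : a \in [set ord0; a'; b'] by rewrite -E !inE eqxx orbT.
  by rewrite !inE (negPf (partA_neq0 aA)) (negPf (AB _ _ aA bB')) orbF => /eqP.
have : b \in [set ord0; a'; b'] by rewrite -E !inE eqxx orbT.
by rewrite !inE (negPf (partB_neq0 bB)) eq_sym (eq_sym b) (negPf (AB _ _ aA' bB)) => /eqP.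
Qed.

Lemma extremal_uniform n : uniform3 (extremal n.+1).
Proof.
apply/forall_inP => e /extremalP[a [b [aA bB ->]]].
have ab : a != b by apply: contraTneq aA => ->; rewrite (disjointFl (partAB_disjoint _) bB).
rewrite setUC cardsU1 cards2 !inE negb_or (eq_sym ord0) (eq_sym b a).
by rewrite (partA_neq0 aA) (partB_neq0 bB) ab.
Qed.

(** A single page suffices for a contradiction. Each of the three hyperedges contains [ord0] and
    omits one vertex of the triangle [uvx], so [ord0] is none of them; then they are pairwise in
    different parts of a bipartition. *)
Lemma extremal_free n t : 0 < t -> trB_free t (extremal n.+1).
Proof.
move=> t0; apply/negP => /existsP[u /existsP[v /existsP[w]]].
set S := _ |: _ => /and5P[uv _ uw vw /and3P[/exists_inP[h1 h1E /eqP h1S]]].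
move=> /forallP/(_ (Ordinal t0))/exists_inP[h2 h2E /eqP h2S].
move=> /forallP/(_ (Ordinal t0))/exists_inP[h3 h3E /eqP h3S].
set x := w (Ordinal t0) in h2S h3S.
have xim : x \in [set w i | i : 'I_t] by apply/imsetP; exists (Ordinal t0).
have ux : u != x by apply: contraNneq uw => ->.
have vx : v != x by apply: contraNneq vw => ->.
have uS : u \in S by rewrite !inE eqxx.
have vS : v \in S by rewrite !inE eqxx orbT.
have xS : x \in S by rewrite !in_setU xim !orbT.
have trace (h : {set 'I_n.+1}) a b c : h :&: S = [set a; b] -> c \in S -> (c \in h) = (c == a) || (c == b).
  by move=> hS cS; move/setP/(_ c): hS; rewrite in_setI cS andbT in_set2.
have in0 h : h \in extremal n.+1 -> ord0 \in h.
  by case/extremalP => a [b [_ _ ->]]; rewrite !inE eqxx.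
have two h a b : h \in extremal n.+1 -> a \in h -> b \in h -> a != ord0 -> b != ord0 -> a != b ->
    (a \in partA n.+1) != (b \in partA n.+1).
  case/extremalP => a' [b' [aA bB ->]]; have nbA := disjointFl (partAB_disjoint _) bB.
  rewrite !in_setU !in_set1 => + + na nb; rewrite (negPf na) (negPf nb) /=.
  by case/orP=> /eqP -> /orP[] /eqP -> //; rewrite ?eqxx // ?aA ?nbA.
have nz a b c h : h \in extremal n.+1 -> h :&: S = [set a; b] -> c \in S -> c != a -> c != b -> c != ord0.
  move=> hE hS cS ca cb; apply: contraTneq (in0 h hE) => <-.
  by rewrite (trace _ _ _ _ hS cS) (negPf ca) (negPf cb).
have u0 : u != ord0 by apply: (nz v x u h3).
have v0 : v != ord0 by apply: (nz u x v h2) => //; rewrite eq_sym.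
have x0 : x != ord0 by apply: (nz u v x h1) => //; rewrite eq_sym.
have := two h1 u v h1E; have := two h2 u x h2E; have := two h3 v x h3E.
rewrite !(trace _ _ _ _ h1S) // !(trace _ _ _ _ h2S) // !(trace _ _ _ _ h3S) // !eqxx !orbT.
move=> /(_ isT isT v0 x0 vx) + /(_ isT isT u0 x0 ux) + /(_ isT isT u0 v0 uv).
by case: (u \in partA _); case: (v \in partA _); case: (x \in partA _).
Qed.

(** A hyperedge has three vertices and at most one in each of [A], [B] and the remainder, hence
    exactly one in each. *)
Lemma edges_through_vertex (V : finType) (H : {set {set V}}) (A B : {set V}) :
  (forall h, h \in H -> #|h| = 3) -> H != set0 -> #|~: (A :|: B)| <= 1 ->
  (forall h x y, h \in H -> x \in h -> y \in h -> x \in A -> y \in A -> x = y) ->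
  (forall h x y, h \in H -> x \in h -> y \in h -> x \in B -> y \in B -> x = y) ->
  exists2 z, ~: (A :|: B) = [set z] &
    forall h, h \in H -> exists a b, [/\ a \in A, b \in B & h = [set z; a; b]].
Proof.
move=> unif /set0Pn[h0 h0H] rest oneA oneB.
have le1 (S h : {set V}) : (forall x y, x \in h -> y \in h -> x \in S -> y \in S -> x = y) ->
    #|h :&: S| <= 1.
  move=> one; apply/card_le1P => x; rewrite in_setI => /andP[xh xS] y.
  rewrite in_setI [RHS]inE; apply/andP/eqP => [[yh yS]|-> //]; exact: one.
have meets h : h \in H -> [/\ 0 < #|h :&: A|, 0 < #|h :&: B| & 0 < #|h :&: ~: (A :|: B)|].
  move=> hH; have hA := le1 A h (fun x y => @oneA h x y hH).
  have hB := le1 B h (fun x y => @oneB h x y hH).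
  have hR : #|h :&: ~: (A :|: B)| <= 1 := leq_trans (subset_leq_card (subsetIr _ _)) rest.
  have := cardsID (A :|: B) h; rewrite (unif h hH) setDE setIUr.
  have := leq_of_leqif (leq_card_setU (h :&: A) (h :&: B)).
  by split; lia.
have /cards1P[z zE] : #|~: (A :|: B)| == 1.
  rewrite eqn_leq rest /=; have [_ _] := meets h0 h0H.
  by move/leq_trans; apply; apply: subset_leq_card (subsetIr _ _).
exists z => // h hH; have [] := meets h hH.
rewrite zE => /card_gt0P[a /setIP[ah aA]] /card_gt0P[b /setIP[bh bB]] /card_gt0P[z' /setIP[zh /set1P zz]].
rewrite {}zz in zh; have : z \in ~: (A :|: B) by rewrite zE set11.
rewrite in_setC in_setU => /norP[zA zB]; exists a, b; split=> //.
have za : z != a by apply: contraNneq zA => ->.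
have zb : z != b by apply: contraNneq zB => ->.
apply: (edge_eq unif hH zh ah bh za); first by rewrite eq_sym.
(* [A] and [B] may overlap here, so [a] and [b] could coincide; the hyperedge would then be
   contained in [[set z; a]]. *)
have := unif h hH; apply: contra_eqN => /eqP ba; rewrite neq_ltn; apply/orP; left.
have sub : h \subset [set z; a].
  apply/subsetP => x xh; apply: contraTT isT; rewrite in_set2 => /norP[xz xa].
  have : x \notin ~: (A :|: B) by rewrite zE in_set1.
  rewrite in_setC negbK => /setUP[xA|xB].
    by rewrite (oneA h x a) ?eqxx in xa.
  by rewrite -ba (oneB h x b) ?eqxx in xa.
by apply: leq_ltn_trans (subset_leq_card sub) _; rewrite cards2 za.
Qed.

Definition joined (V : finType) (z : V) (A B : {set V}) : {set {set V}} :=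
  (fun p : V * V => [set z; p.1; p.2]) @: setX A B.

Lemma joined_sym (V : finType) (z : V) (A B : {set V}) : joined z A B = joined z B A.
Proof.
by apply/setP => e; apply/imsetP/imsetP => -[[a b]]; rewrite in_setX => /andP[aA bB] ->;
   exists (b, a); rewrite ?in_setX ?aA ?bB //= setUAC.
Qed.

Lemma card_joined (V : finType) (z : V) (A B : {set V}) : #|joined z A B| <= #|A| * #|B|.
Proof. by rewrite -cardsX leq_imset_card. Qed.

Lemma joined_hiso n (z : 'I_n.+1) (A B : {set 'I_n.+1}) :
  [disjoint A & B] -> ~: (A :|: B) = [set z] -> #|A| = n./2 ->
  hiso (joined z A B) (extremal n.+1).
Proof.
move=> disj rest cA.
have cB : #|B| = uphalf n.
  have := cardsC (A :|: B); rewrite rest cards1 card_ord.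
  have := cardsUI A B; rewrite (disjoint_setI0 disj) cards0 cA uphalf_half.
  by have := odd_double_half n; lia.
(* Listing [z], then [A], then [B] matches the numbering in [extremal], where 0 is the centre and
   the next [n./2] positions form [partA]; the isomorphism sends [i] to the entry at position
   [i]. *)
pose L := z :: enum A ++ enum B.
have sizeL : size L = n.+1.
  by rewrite /= size_cat -!cardE cA cB uphalf_half; have := odd_double_half n; lia.
have [zA zB] : z \notin A /\ z \notin B.
  by apply/norP; rewrite -in_setU -in_setC rest set11.
have uniqL : uniq L.
  rewrite /= mem_cat !mem_enum negb_or zA zB cat_uniq !enum_uniq /= andbT.
  by apply/hasPn => x; rewrite !mem_enum => xB; rewrite (disjointFl disj xB).
have s_inj : injective (fun i : 'I_n.+1 => nth z L i).
  move=> i j /eqP; rewrite nth_uniq ?sizeL ?ltn_ord // => /eqP; exact: val_inj.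
pose s := perm s_inj; exists s.
have s0 : s ord0 = z by rewrite permE.
have sA : s @: partA n.+1 = A.
  apply/eqP; rewrite eqEcard card_imset ?card_partA ?cA ?leqnn ?andbT; last exact: perm_inj.
  apply/subsetP => _ /imsetP[[[|j] jlt] + ->]; rewrite inE permE //= => jn.
  rewrite nth_cat -cardE cA jn.
  by rewrite -mem_enum mem_nth // -cardE cA.
have sB : s @: partB n.+1 = B.
  apply/eqP; rewrite eqEcard card_imset ?card_partB ?cB ?leqnn ?andbT; last exact: perm_inj.
  apply/subsetP => _ /imsetP[[[|j] jlt] + ->]; rewrite inE permE //= => jn.
  rewrite nth_cat -cardE cA ltnNge -ltnS jn /= -mem_enum mem_nth // -cardE cB uphalf_half.
  by have := odd_double_half n; lia.
have sE a b : s @: [set ord0; a; b] = [set z; s a; s b] by rewrite !imsetU !imset_set1 s0.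
apply/setP => e; apply/imsetP/imsetP => [[[a b]]|[e' /extremalP[a [b [aA bB ->]]] ->]].
  rewrite in_setX -sA -sB => /andP[/imsetP[a' aA ->] /imsetP[b' bB ->]] ->.
  by exists [set ord0; a'; b']; rewrite ?sE //; apply/extremalP; exists a', b'.
by exists (s a, s b); rewrite ?sE // in_setX -sA -sB !imset_f.
Qed.

Lemma balanced_parts a b n : a + b = n -> a * b = n ^ 2 %/ 4 -> a = n./2 \/ b = n./2.
Proof.
rewrite -half_mul_uphalf uphalf_half => abn; have := odd_double_half n.
by move: (n./2) (odd n) => k [] /=; nia.
Qed.

Lemma mul_parts a b n : a + b = n -> a * b <= n ^ 2 %/ 4.
Proof. by move=> <-; rewrite leq_divRL // mulnC; exact: nat_AGM2. Qed.

(** [H] is contained in [joined z A B], whose size is at most [#|A| * #|B|] and thus at most the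
    assumed lower bound on [#|H|]. Equality holds throughout, and it forces the parts to be
    balanced. *)
Lemma extremal_structure t : exists n0 : nat, forall m (H : {set {set 'I_m.+1}}),
  n0 <= m -> uniform3 H -> trB_free t H -> m ^ 2 %/ 4 <= #|H| ->
  #|H| <= m ^ 2 %/ 4 /\ hiso H (extremal m.+1).
Proof.
(* [5 * t] is the page bound of [few_pages]; the [+ 2] makes [m ^ 2 %/ 4] positive, so that [H] is
   nonempty. *)
have [n0 n0P] := structure (5 * t); exists (n0 + 2) => m H mn unif free Hlow.
have unif' h : h \in H -> #|h| = 3 by move=> hH; apply/eqP; apply: (forall_inP unif).
have m4 : m ^ 2 < (#|H| + 1) * 4.
  by apply: leq_trans (ltn_ceil _ (isT : 0 < 4)) _; rewrite leq_mul2r /= addn1 ltnS.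
have Hrat : ((#|'I_m.+1|%:R - 1) ^+ 2 / 4 - 1 <= #|H|%:R :> rat)%R.
  move: m4; rewrite card_ord -natr1 addrK -(ltr_nat rat) natrM natrX natrD => m4.
  by rewrite lerBlDr ler_pdivrMr // ltW.
have nV : n0 <= #|'I_m.+1| by rewrite card_ord; lia.
have [A [B [disj rest oneA oneB]]] :=
  n0P _ H unif' (fun u v uv => few_pages unif free uv) nV Hrat.
have Hne : H != set0.
  rewrite -card_gt0; apply: leq_trans Hlow; rewrite divn_gt0 //.
  by rewrite (leq_sqr 2); lia.
have [z restE HE] := edges_through_vertex unif' Hne rest oneA oneB.
have cAB : #|A| + #|B| = m.
  have := cardsC (A :|: B); rewrite restE cards1 card_ord.
  by have := cardsUI A B; rewrite (disjoint_setI0 disj) cards0; lia.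
have sub : H \subset joined z A B.
  apply/subsetP => h /HE[a [b [aA bB ->]]]; apply/imsetP; exists (a, b) => //.
  by rewrite in_setX aA.
have le1 := leq_trans (subset_leq_card sub) (card_joined z A B).
have le2 := mul_parts cAB; split; first exact: leq_trans le1 le2.
have -> : H = joined z A B.
  by apply/eqP; rewrite eqEcard sub (leq_trans (card_joined z A B)) // (leq_trans le2).
have E : #|A| * #|B| = m ^ 2 %/ 4.
  by apply/eqP; rewrite eqn_leq le2 (leq_trans Hlow).
case: (balanced_parts cAB E) => half; first exact: joined_hiso.
by rewrite joined_sym; apply: joined_hiso; rewrite // 1?disjoint_sym // setUC.
Qed.

Theorem theorem1 :
  forall t : nat, 0 < t ->
  exists n0 : nat, forall n : nat, n0 <= n ->
    [/\ ex3_trB n t = (n.-1 ^ 2) %/ 4,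
        uniform3 (extremal n) /\ trB_free t (extremal n),
        #|extremal n| = (n.-1 ^ 2) %/ 4 &
        forall H : {set {set 'I_n}}, uniform3 H -> trB_free t H ->
          #|H| = ex3_trB n t -> hiso H (extremal n)].
Proof.
move=> t t0; have [n0 n0P] := extremal_structure t.
exists n0.+1 => -[//|m] nm; rewrite ltnS in nm.
have exE : ex3_trB m.+1 t = m ^ 2 %/ 4.
  apply/eqP; rewrite eqn_leq; apply/andP; split.
    (* A hypergraph beyond the bound satisfies the size hypothesis of [extremal_structure], whose
       conclusion then refutes it. *)
    apply/bigmax_leqP => H /andP[unif free]; rewrite leqNgt; apply/negP => gt.
    by have [] := n0P m H nm unif free (ltnW gt); rewrite leqNgt gt.
  rewrite -{1}(card_extremal m); apply: (leq_bigmax_cond (extremal m.+1)).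
  by rewrite extremal_uniform extremal_free.
split=> //.
- by rewrite extremal_uniform extremal_free.
- exact: card_extremal.
- move=> H unif free cH; have [] := n0P m H nm unif free; last by [].
  by rewrite cH exE.
Qed.
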